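(* There exist absolute constants $c, C>0$ such that the following holds. Consider a multi-objective LQR instance $(A,B,(Q_i,R_i)_{i\in[m]},\sigma)$ satisfying the standing assumption in the context, with the quantities $\Gamma,\overline\gamma,\overline\tau$ defined in the context. Let $\epsilon>0$ satisfy $$\epsilon \le c\,\frac{(1-\overline\gamma^2)^4}{\overline\tau^4}\,\Gamma^{-17},$$ let $N_\epsilon\subseteq\Delta([m])$ be an $\epsilon$-net of $\Delta([m])$ in $\ell_1$ (for every $w\in\Delta([m])$ there is $w_\epsilon\in N_\epsilon$ with $\|w-w_\epsilon\|_1\le\epsilon$), and let $\mathsf{PF}_\epsilon(\mathcal S)=\{K_{w_\epsilon}: w_\epsilon\in N_\epsilon\}$. Then for every Pareto optimal $K\in\mathsf{PF}(\mathcal S)$ there exists $K_\epsilon\in\mathsf{PF}_\epsilon(\mathcal S)$ with $$\|\vec{\mathcal L}(K)-\vec{\mathcal L}(K_\epsilon)\|_\infty\le C\,\sigma^2 n\,\Gamma^{29}\,\frac{\overline\tau^8}{(1-\overline\gamma^2)^4}\,\epsilon .$$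
   Context: Matrix norms are spectral operator norms; $\rho(\cdot)$ is spectral radius, $\sigma_{\min}(\cdot)$ the smallest singular value; $\|M\|_+=1+\|M\|$; $[m]=\{1,\dots,m\}$; $\Delta([m])=\{w\in\mathbb R^m_{\ge0}:\|w\|_1=1\}$. Setting. $A\in\mathbb R^{n\times n}$, $B\in\mathbb R^{n\times d}$ with $n\ge d$; symmetric cost matrices $Q_i\in\mathbb R^{n\times n}$, $R_i\in\mathbb R^{d\times d}$, $i\in[m]$; $\sigma>0$. Standing assumption: $(A,B)$ is stabilizable, each $Q_i$ and $R_i$ is positive definite, and $\sigma_{\min}(Q_i),\sigma_{\min}(R_i)\ge1$ for all $i$. The set of stabilizing controls is $\mathcal S=\{K\in\mathbb R^{d\times n}:\rho(A+BK)<1\}$. For $K\in\mathcal S$ define $$\mathcal L(K,Q,R)=\lim_{T\to\infty}\mathbb E\Big[\frac1T\sum_{t=0}^T (x_t^\top Qx_t+u_t^\top Ru_t)\Big],\quad x_{t+1}=Ax_t+Bu_t+\xi_t,\ u_t=Kx_t,$$ where $x_0\sim N(0,I_n)$ and the $\xi_t\sim N(0,\sigma^2I_n)$ are independent of each other and of $x_0$. Write $\mathcal L_i(K)=\mathcal L(K,Q_i,R_i)$ and $\vec{\mathcal L}(K)=(\mathcal L_1(K),\dots,\mathcal L_m(K))$. Pareto optimality. $K\in\mathcal S$ is Pareto optimal if there is no $K'\in\mathcal S$ with $\mathcal L_i(K')\le\mathcal L_i(K)$ for all $i$ and $\mathcal L_j(K')<\mathcal L_j(K)$ for some $j$; $\mathsf{PF}(\mathcal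 S)$ is the set of Pareto optimal controls. Scalarization. $\mathsf{dare}(A,B,Q,R)$ denotes the unique positive semidefinite solution $P$ of $P=A^\top PA-A^\top PB(R+B^\top PB)^{-1}B^\top PA+Q$. For $w\in\Delta([m])$: $Q_w=\sum_iw_iQ_i$, $R_w=\sum_iw_iR_i$, $P_w=\mathsf{dare}(A,B,Q_w,R_w)$, $K_w=-(R_w+B^\top P_wB)^{-1}B^\top P_wA$ (the optimal controller for the LQR problem with costs $Q_w,R_w$). Constants. $P_{\max}=\sup_{w\in\Delta([m])}\|P_w\|$, $K_{\max}=\sup_{w\in\Delta([m])}\|K_w\|$, $$\Gamma=\max\{1+P_{\max},\,1+K_{\max},\,\|A\|_+,\,\|B\|_+,\,\max_i\|Q_i\|,\,\max_i\|R_i\|,\,1+m\max_i\|R_i^{-1}\|\}.$$ For a square matrix $L$ and $\rho>0$, $\tau(L,\rho)=\sup_{k\ge0}\|L^k\|\rho^{-k}$. The numbers $\overline\gamma\in(0,1)$ and $\overline\tau<\infty$ are fixed constants such that $\rho(A+BK_w)\le\overline\gamma$ and $\tau(A+BK_w,\overline\gamma)\le\overline\tau$ for all $w\in\Delta([m])$ (such constants exist). *)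

(* Defs.v *)
From HB Require Import structures.
From mathcomp Require Import all_boot all_order all_algebra complex.
From mathcomp Require Import all_classical all_reals all_analysis.

Set Implicit Arguments.
Unset Strict Implicit.
Unset Printing Implicit Defensive.

Import Order.TTheory GRing.Theory Num.Theory.
Import numFieldNormedType.Exports.

Local Open Scope classical_set_scope.
Local Open Scope ring_scope.

Section LinearAlgebra.
Context {R : realType}.

Definition norm2 n (v : 'cV[R]_n) : R := Num.sqrt (\sum_i v i 0 ^+ 2).

Definition opnorm p q (M : 'M[R]_(p, q)) : R :=
  sup [set norm2 (M *m v) | v in [set v : 'cV[R]_q | norm2 v <= 1]].

Definition opnorm_plus p q (M : 'M[R]_(p, q)) : R := 1 + opnorm M.

(* M is viewed as a complex matrix: its real spectrum may be empty. *)
Definition spectral_radius n (M : 'M[R]_n) : R :=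
  sup [set ComplexField.Normc.normc z |
        z in [set z : R[i] | eigenvalue (map_mx (real_complex R) M) z]].

(* The singular values of M are the square roots of the eigenvalues of M^T M,
   all of which are real. *)
Definition sigma_min n (M : 'M[R]_n) : R :=
  inf [set Num.sqrt a | a in [set a : R | eigenvalue (M^T *m M) a]].

Definition quad n (M : 'M[R]_n) (v : 'cV[R]_n) : R := (v^T *m M *m v) 0 0.

Definition posdef n (M : 'M[R]_n) : Prop :=
  M^T = M /\ forall v, v != 0 -> 0 < quad M v.

Definition possemidef n (M : 'M[R]_n) : Prop :=
  M^T = M /\ forall v, 0 <= quad M v.

(* Extended-real valued, since the supremum may be infinite. *)
Definition tau n (M : 'M[R]_n) (rho : R) : \bar R :=
  ereal_sup [set (opnorm (M ^+ k) * rho ^- k)%:E | k in [set: nat]].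

Definition norm1 m (v : 'rV[R]_m) : R := \sum_i `|v 0 i|.

Definition simplex m : set 'rV[R]_m :=
  [set w : 'rV[R]_m | (forall i, 0 <= w 0 i) /\ norm1 w = 1].

End LinearAlgebra.
Arguments simplex {R} m _.

Definition l1_net (R : realType) m (eps : R) (N : set 'rV[R]_m) : Prop :=
  N `<=` simplex m /\
  forall w, simplex m w -> exists2 w', N w' & norm1 (w - w') <= eps.

Section RandomVectors.
Context {R : realType} {disp : measure_display} {Omega : measurableType disp}.
Variable P : probability Omega R.

(* X ~ N(0, s^2 I_n): the law of X is the n-fold product of the normal law with
   mean 0 and standard deviation s, as tested on measurable boxes. *)
Definition isotropic_normal n (s : R) (X : {RV P >-> n.-tuple R}) : Prop :=
  forall U : 'I_n -> set R, (forall i, measurable (U i)) ->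
    distribution P X [set v | forall i, U i (tnth v i)] =
    (\prod_(i < n) normal_prob 0 s (U i))%E.

Definition mutually_independent n (X : nat -> {RV P >-> n.-tuple R}) : Prop :=
  forall (J : seq nat) (U : nat -> set (n.-tuple R)),
    uniq J -> (forall t, measurable (U t)) ->
    P (\bigcap_(t in [set` J]) (X t @^-1` U t)) =
    (\prod_(t <- J) P (X t @^-1` U t))%E.

(* x0, xi 0, xi 1, ... as a single family. *)
Definition noise_family n (x0 : {RV P >-> n.-tuple R})
    (xi : nat -> {RV P >-> n.-tuple R}) (t : nat) : {RV P >-> n.-tuple R} :=
  if t is t'.+1 then xi t' else x0.

Definition lqr_noise n (sigma : R) (x0 : {RV P >-> n.-tuple R})
    (xi : nat -> {RV P >-> n.-tuple R}) : Prop :=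
  [/\ isotropic_normal 1 x0,
      forall t, isotropic_normal sigma (xi t) &
      mutually_independent (noise_family x0 xi)].

End RandomVectors.

Section LQR.
Context {R : realType} {n d : nat}.
Variables (A : 'M[R]_n) (B : 'M[R]_(n, d)).

Definition stabilizing : set 'M[R]_(d, n) :=
  [set K | spectral_radius (A + B *m K) < 1].

Definition stabilizable : Prop := exists K, stabilizing K.

Section Cost.
Context {disp : measure_display} {Omega : measurableType disp}.
Variable P : probability Omega R.
Variables (x0 : {RV P >-> n.-tuple R}) (xi : nat -> {RV P >-> n.-tuple R}).

Definition cV_of_tuple (v : n.-tuple R) : 'cV[R]_n := \col_i tnth v i.

Fixpoint state (K : 'M[R]_(d, n)) (t : nat) (omega : Omega) : 'cV[R]_n :=
  if t is t'.+1 then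
    A *m state K t' omega + B *m (K *m state K t' omega)
      + cV_of_tuple (xi t' omega)
  else cV_of_tuple (x0 omega).

Definition control (K : 'M[R]_(d, n)) (t : nat) (omega : Omega) : 'cV[R]_d :=
  K *m state K t omega.

Definition average_cost (Q : 'M[R]_n) (Rc : 'M[R]_d) (K : 'M[R]_(d, n))
    (T : nat) (omega : Omega) : R :=
  T%:R^-1 * \sum_(0 <= t < T.+1)
    (quad Q (state K t omega) + quad Rc (control K t omega)).

(* Only meaningful for stabilizing K: there the expectations are finite and
   converge, otherwise fine and lim may return default values. *)
Definition lqr_cost (Q : 'M[R]_n) (Rc : 'M[R]_d) (K : 'M[R]_(d, n)) : R :=
  lim ((fun T => fine 'E_P[average_cost Q Rc K T]) @ \oo).

Definition lqr_costs m (Q : 'I_m -> 'M[R]_n) (Rc : 'I_m -> 'M[R]_d)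
    (K : 'M[R]_(d, n)) : 'rV[R]_m :=
  \row_i lqr_cost (Q i) (Rc i) K.

End Cost.

Definition dare_solution (Q : 'M[R]_n) (Rc : 'M[R]_d) (P : 'M[R]_n) : Prop :=
  possemidef P /\
  P = A^T *m P *m A
      - A^T *m P *m B *m invmx (Rc + B^T *m P *m B) *m B^T *m P *m A + Q.

(* The solution is unique whenever (A, B) is stabilizable and Q, Rc are positive
   definite; xget picks it. *)
Definition dare (Q : 'M[R]_n) (Rc : 'M[R]_d) : 'M[R]_n :=
  xget 0 [set P | dare_solution Q Rc P].

Section Scalarization.
Context {m : nat}.
Variables (Q : 'I_m -> 'M[R]_n) (Rc : 'I_m -> 'M[R]_d).

Definition Qw (w : 'rV[R]_m) : 'M[R]_n := \sum_i w 0 i *: Q i.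

Definition Rw (w : 'rV[R]_m) : 'M[R]_d := \sum_i w 0 i *: Rc i.

Definition Pw (w : 'rV[R]_m) : 'M[R]_n := dare (Qw w) (Rw w).

Definition Kw (w : 'rV[R]_m) : 'M[R]_(d, n) :=
  - (invmx (Rw w + B^T *m Pw w *m B) *m B^T *m Pw w *m A).

Definition Pmax : R := sup [set opnorm (Pw w) | w in simplex m].

Definition Kmax : R := sup [set opnorm (Kw w) | w in simplex m].

Definition Gamma : R :=
  \big[Num.max/0]_(x <- [:: 1 + Pmax; 1 + Kmax; opnorm_plus A; opnorm_plus B;
      \big[Num.max/0]_i opnorm (Q i);
      \big[Num.max/0]_i opnorm (Rc i);
      1 + m%:R * \big[Num.max/0]_i opnorm (invmx (Rc i))]) x.

End Scalarization.
End LQR.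

Definition pareto_optimal (R : realType) (T : Type) (m : nat) (S : set T)
    (L : T -> 'rV[R]_m) : set T :=
  [set K | S K /\
    ~ exists K', [/\ S K', (forall i, L K' 0 i <= L K 0 i) &
                     exists j, L K' 0 j < L K 0 j]].

(* Main.v *)
(* For stabilizing K the cost equals s2 * tr X, where s2 is the second moment of a
   noise component and X = L^T X L + Q + K^T R K with L = A + B K: the traces
   tr (X Sigma_t), Sigma_t the state covariance, telescope, up to a bounded error.

   Completing the square in the Riccati equation shows that the X of any stabilizing
   K, for the costs Q_w and R_w, dominates P_w, with equality at K_w.  Evaluating the
   costs of w at K_{w'} and conversely gives two one-sided bounds on P_w - P_{w'},
   linear in |w - w'|_1 with no smallness condition; K_w and then every L_i(K_w) are
   therefore Lipschitz in w.

   Given a Pareto optimal K, let w maximize the scalarized gap w . (L(K_w) - L(K)) over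
   the simplex.  The gap is never positive, since K_w is optimal for w, and the
   first-order condition at the maximizer gives L_i(K_w) <= L_i(K) for all i, hence
   L(K_w) = L(K) by Pareto optimality.  Any net point close to w concludes. *)
Require Import Defs.
From HB Require Import structures.
From mathcomp Require Import all_boot all_order all_algebra complex.
From mathcomp Require Import all_classical all_reals all_analysis.
From mathcomp Require Import measurable_realfun.
From mathcomp Require Import ring lra.

Set Implicit Arguments.
Unset Strict Implicit.
Unset Printing Implicit Defensive.

Import Order.TTheory GRing.Theory Num.Theory.
Import numFieldNormedType.Exports.

Local Open Scope classical_set_scope.
Local Open Scope ring_scope.

(** * Bilinear forms and operator norm bounds *)

Section BilinearForms.
Context {R : realType}.

(** Two kinds of stability constants occur. The gains [Kw w] share the pair [taubar], [gammabar],
    which fixes every explicit constant. An arbitrary stabilizing gain is only known to have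
    spectral radius below one; some unspecified geometric decay is extracted from that by
    Cayley-Hamilton, and it suffices because such a gain serves only in exact identities,
    comparisons and finiteness claims. [dare] and the suprema [Pmax], [Kmax] return default values
    when there is no solution or no bound. Hence solvability of the Riccati equation and boundedness
    over the simplex come before any use of [Gamma]. All estimates are monomials in G = [Gamma] and
    T = taubar^2 / (1 - gammabar^2), both at least 1 (for T because n > 0), so lower-order terms are
    rounded up. Per unit of weight in l1, P_w moves by 2 G^3 T, K_w by 5 G^7 T and each Lyapunov
    solution by 50 G^13 T^3. The trace contributes n and the second moment of the noise is bounded
    by 16 sigma^2, whence C = 16 * 50; the powers G^29 and T^4 of the statement leave slack. *)

Definition bil p q (M : 'M[R]_(p, q)) (u : 'cV[R]_p) (v : 'cV[R]_q) : R :=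
  (u^T *m M *m v) 0 0.

Lemma quadE n (M : 'M[R]_n) v : quad M v = bil M v v.
Proof. by []. Qed.

Lemma bilDl p q (M : 'M[R]_(p, q)) u1 u2 v :
  bil M (u1 + u2) v = bil M u1 v + bil M u2 v.
Proof. by rewrite /bil linearD !mulmxDl mxE. Qed.

Lemma bilDr p q (M : 'M[R]_(p, q)) u v1 v2 :
  bil M u (v1 + v2) = bil M u v1 + bil M u v2.
Proof. by rewrite /bil mulmxDr mxE. Qed.

Lemma bil_sumE p q (M : 'M[R]_(p, q)) u v :
  bil M u v = \sum_j \sum_i u i 0 * M i j * v j 0.
Proof.
rewrite /bil mxE; apply: eq_bigr => j _; rewrite mxE mulr_suml.
by apply: eq_bigr => i _; rewrite mxE.
Qed.

Lemma bilZl p q (M : 'M[R]_(p, q)) a u v : bil M (a *: u) v = a * bil M u v.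
Proof. by rewrite /bil linearZ -!scalemxAl mxE. Qed.

Lemma bilZr p q (M : 'M[R]_(p, q)) a u v : bil M u (a *: v) = a * bil M u v.
Proof. by rewrite /bil -scalemxAr mxE. Qed.

Lemma bilMD p q (M N : 'M[R]_(p, q)) u v : bil (M + N) u v = bil M u v + bil N u v.
Proof. by rewrite /bil mulmxDr mulmxDl mxE. Qed.

Lemma bilMB p q (M N : 'M[R]_(p, q)) u v : bil (M - N) u v = bil M u v - bil N u v.
Proof. by rewrite /bil mulmxBr mulmxBl mxE [X in _ + X]mxE. Qed.

Lemma bilMZ p q a (M : 'M[R]_(p, q)) u v : bil (a *: M) u v = a * bil M u v.
Proof. by rewrite /bil -scalemxAr -scalemxAl mxE. Qed.

Lemma bilM_sum p q (I : Type) (r : seq I) (F : I -> 'M[R]_(p, q)) u v :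
  bil (\sum_(i <- r) F i) u v = \sum_(i <- r) bil (F i) u v.
Proof.
elim: r => [|i r IH]; last by rewrite !big_cons bilMD IH.
by rewrite !big_nil /bil mulmx0 mul0mx mxE.
Qed.

Lemma bil_mulml p q r (M : 'M[R]_(p, q)) (L : 'M[R]_(p, r)) u v :
  bil (L^T *m M) u v = bil M (L *m u) v.
Proof. by rewrite /bil trmx_mul !mulmxA. Qed.

Lemma bil_mulmr p q r (M : 'M[R]_(p, q)) (L : 'M[R]_(q, r)) u v :
  bil (M *m L) u v = bil M u (L *m v).
Proof. by rewrite /bil !mulmxA. Qed.

Lemma bilT p q (M : 'M[R]_(p, q)) u v : bil M^T v u = bil M u v.
Proof.
rewrite /bil -[in RHS](trmxK (u^T *m M *m v)) [in RHS]mxE.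
by rewrite !trmx_mul trmxK mulmxA.
Qed.

Lemma bil1 n (v : 'cV[R]_n) : bil 1%:M v v = norm2 v ^+ 2.
Proof.
rewrite /bil mulmx1 /norm2 sqr_sqrtr ?sumr_ge0// => [|i _]; last exact: sqr_ge0.
by rewrite mxE; apply: eq_bigr => i _; rewrite mxE expr2.
Qed.

Lemma bil_delta p q (M : 'M[R]_(p, q)) i j :
  bil M (delta_mx i 0) (delta_mx j 0) = M i j.
Proof. by rewrite /bil trmx_delta -rowE -colE !mxE. Qed.

Lemma quadD n (M : 'M[R]_n) u v : M^T = M ->
  quad M (u + v) = quad M u + bil M u v *+ 2 + quad M v.
Proof.
move=> sM; rewrite !quadE bilDl !bilDr -(bilT _ v u) sM.
by rewrite mulr2n; ring.
Qed.

Lemma quadZ n (M : 'M[R]_n) a v : quad M (a *: v) = a ^+ 2 * quad M v.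
Proof. by rewrite !quadE bilZl bilZr mulrA. Qed.

(** Nonnegativity of t |-> [quad M (u + t *: v)], a polynomial of degree at most two. Since M may be
    singular, the case of a vanishing leading coefficient is separate. *)
Lemma bil_CauchySchwarz n (M : 'M[R]_n) u v : possemidef M ->
  bil M u v ^+ 2 <= quad M u * quad M v.
Proof.
move=> [sM M0]; set a := quad M u; set c := quad M v; set b := bil M u v.
have H t : 0 <= a + (t * b) *+ 2 + t ^+ 2 * c.
  by have := M0 (u + t *: v); rewrite quadD// bilZr quadZ.
have := M0 v; rewrite -/c le_eqVlt => /orP[/eqP c0|c0].
  rewrite -c0 mulr0; suff -> : b = 0 by rewrite expr0n.
  (* With c = 0 the polynomial is affine; this t gives it the value -1. *)
  apply/eqP/negPn/negP => b0; have := H (- (a + 1) / (b *+ 2)).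
  rewrite -c0 mulr0 addr0.
  suff -> : (- (a + 1) / (b *+ 2) * b) *+ 2 = - (a + 1) by lra.
  by field.
(* The minimizer of the quadratic. *)
have := H (- b / c).
have -> : a + (- b / c * b) *+ 2 + (- b / c) ^+ 2 * c = a - b ^+ 2 / c.
  by field; rewrite gt_eqF.
by rewrite subr_ge0 ler_pdivrMr.
Qed.

Lemma norm2_ge0 n (v : 'cV[R]_n) : 0 <= norm2 v.
Proof. exact: sqrtr_ge0. Qed.

Lemma possemidef1 n : possemidef (1%:M : 'M[R]_n).
Proof. by split=> [|v]; rewrite ?trmx1// quadE bil1 sqr_ge0. Qed.

Lemma ler_dot n (u v : 'cV[R]_n) : `|bil 1%:M u v| <= norm2 u * norm2 v.
Proof.
rewrite -(@ler_pXn2r _ 2) ?nnegrE ?mulr_ge0 ?norm2_ge0//.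
rewrite real_normK ?num_real// exprMn -!bil1.
exact: bil_CauchySchwarz (possemidef1 n).
Qed.

Lemma norm2Z n a (v : 'cV[R]_n) : norm2 (a *: v) = `|a| * norm2 v.
Proof.
apply/eqP; rewrite -(@eqrXn2 _ 2) ?mulr_ge0 ?norm2_ge0//.
by rewrite exprMn -!bil1 -!quadE quadZ real_normK ?num_real.
Qed.

Lemma norm2_eq0 n (v : 'cV[R]_n) : norm2 v = 0 -> v = 0.
Proof.
move=> v0; have : norm2 v ^+ 2 = 0 by rewrite v0 expr0n.
rewrite /norm2 sqr_sqrtr ?sumr_ge0// => [|i _]; last exact: sqr_ge0.
move=> /eqP; rewrite psumr_eq0 => [|i _]; last exact: sqr_ge0.
move=> /allP H; apply/matrixP => i j; rewrite ord1 mxE; apply/eqP.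
by have := H i (mem_index_enum _); rewrite sqrf_eq0.
Qed.

Lemma norm2_delta n (i : 'I_n) : norm2 (delta_mx i 0 : 'cV[R]_n) = 1.
Proof.
apply/eqP; rewrite -(@eqrXn2 _ 2) ?norm2_ge0// -bil1 bil_delta !mxE eqxx.
by rewrite expr1n.
Qed.

Lemma norm20 n : norm2 (0 : 'cV[R]_n) = 0.
Proof. by rewrite -(scale0r 0) norm2Z normr0 mul0r. Qed.

End BilinearForms.

Section BoundedMatrices.
Context {R : realType}.

(** Says that the operator norm is at most c, but as a bound on the bilinear form: it is symmetric
    under transposition, additive, and free of suprema. [bnd_opnorm] and [opnorm_le] translate. *)
Definition bnd p q (c : R) (M : 'M[R]_(p, q)) : Prop :=
  forall u v, `|bil M u v| <= c * (norm2 u * norm2 v).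

Lemma bndP p q (c : R) (M : 'M[R]_(p, q)) : 0 <= c ->
  (bnd c M <-> forall v, norm2 (M *m v) <= c * norm2 v).
Proof.
move=> c0; split=> [H v|H u v].
  have [->|Mv0] := eqVneq (norm2 (M *m v)) 0; first by rewrite mulr_ge0 ?norm2_ge0.
  have Mv : 0 < norm2 (M *m v) by rewrite lt_neqAle eq_sym Mv0 norm2_ge0.
  rewrite -(ler_pM2l Mv) -expr2 -bil1; apply: le_trans (ler_norm _) _.
  by rewrite -bil_mulmr mul1mx mulrCA; exact: H.
rewrite -{1}(mul1mx M) bil_mulmr; apply: le_trans (ler_dot _ _) _.
by rewrite mulrCA ler_wpM2l ?norm2_ge0.
Qed.

Lemma bnd_le p q c c' (M : 'M[R]_(p, q)) : c <= c' -> bnd c M -> bnd c' M.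
Proof.
by move=> cc H u v; apply: le_trans (H u v) _; rewrite ler_wpM2r ?mulr_ge0 ?norm2_ge0.
Qed.

Lemma bndT p q c (M : 'M[R]_(p, q)) : bnd c M -> bnd c M^T.
Proof. by move=> H u v; rewrite bilT mulrC [_ * norm2 v]mulrC mulrC; exact: H. Qed.

Lemma bndD p q c c' (M M' : 'M[R]_(p, q)) : bnd c M -> bnd c' M' ->
  bnd (c + c') (M + M').
Proof.
by move=> H H' u v; rewrite bilMD mulrDl; apply: le_trans (ler_normD _ _) _; rewrite lerD.
Qed.

Lemma bndZ p q c a (M : 'M[R]_(p, q)) : bnd c M -> bnd (`|a| * c) (a *: M).
Proof. by move=> H u v; rewrite bilMZ normrM -mulrA ler_wpM2l. Qed.

Lemma bndN p q c (M : 'M[R]_(p, q)) : bnd c M -> bnd c (- M).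
Proof. by move/(@bndZ _ _ _ (-1)); rewrite scaleN1r normrN1 mul1r. Qed.

Lemma bnd_sum p q (I : Type) (r : seq I) (c : I -> R) (F : I -> 'M[R]_(p, q)) :
  (forall i, bnd (c i) (F i)) -> bnd (\sum_(i <- r) c i) (\sum_(i <- r) F i).
Proof.
move=> H; elim: r => [|i r IH]; last by rewrite !big_cons; exact: bndD.
by rewrite !big_nil => u v; rewrite /bil mulmx0 mul0mx mxE normr0 mul0r.
Qed.

Lemma bndM p q r c c' (M : 'M[R]_(p, q)) (M' : 'M[R]_(q, r)) : 0 <= c -> 0 <= c' ->
  bnd c M -> bnd c' M' -> bnd (c * c') (M *m M').
Proof.
move=> c0 c0' /(bndP _ c0) H /(bndP _ c0') H'; apply/bndP; first by rewrite mulr_ge0.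
move=> v; rewrite -mulmxA; apply: le_trans (H _) _.
by rewrite -mulrA ler_wpM2l.
Qed.

(** Sums the rank-one matrices [delta_mx i j], each of norm at most 1. The bound is crude, but it
    makes [opnorm] a genuine supremum and turns entrywise convergence or decay into norm
    estimates. *)
Lemma bnd_entries p q (M : 'M[R]_(p, q)) : bnd (\sum_i \sum_j `|M i j|) M.
Proof.
rewrite [X in bnd _ X]matrix_sum_delta; apply: bnd_sum => i; apply: bnd_sum => j.
rewrite -[X in bnd X]mulr1; apply: bndZ => u v.
rewrite mul1r (_ : delta_mx i j = delta_mx i 0 *m (delta_mx j 0 : 'cV_q)^T); last first.
  by rewrite trmx_delta mul_delta_mx.
rewrite -[_ *m _^T]mulmx1 -mulmxA.
rewrite (_ : bil _ u v = bil 1%:M u (delta_mx i 0) * bil 1%:M (delta_mx j 0) v).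
  rewrite normrM ler_pM//.
    by apply: le_trans (ler_dot _ _) _; rewrite norm2_delta mulr1.
  by apply: le_trans (ler_dot _ _) _; rewrite norm2_delta mul1r.
rewrite /bil !mulmx1 mulmxA.
by rewrite -!mulmxA mulmxA [LHS]mxE big_ord1.
Qed.

Lemma entry_le_bnd p q c (M : 'M[R]_(p, q)) i j : bnd c M -> `|M i j| <= c.
Proof.
by move=> /(_ (delta_mx i 0) (delta_mx j 0)); rewrite bil_delta !norm2_delta !mulr1.
Qed.

Lemma mxtrace_bnd n c (M : 'M[R]_n) : bnd c M -> `|\tr M| <= n%:R * c.
Proof.
move=> H; apply: le_trans (ler_norm_sum _ _ _) _.
rewrite mulr_natl -[X in _ *+ X]card_ord -sumr_const.
by apply: ler_sum => i _; exact: entry_le_bnd.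
Qed.

Lemma opnorm_has_sup p q (M : 'M[R]_(p, q)) :
  has_sup [set norm2 (M *m v) | v in [set v : 'cV[R]_q | norm2 v <= 1]].
Proof.
split; first by exists (norm2 (M *m 0)), 0 => //=; rewrite norm20 ler01.
exists (\sum_i \sum_j `|M i j|) => _ [v /= v1 <-].
have c0 : 0 <= \sum_i \sum_j `|M i j| by rewrite !sumr_ge0// => *; rewrite sumr_ge0.
have /(bndP _ c0) H := bnd_entries M.
by apply: le_trans (H v) _; rewrite ler_piMr.
Qed.

Lemma opnorm_ge0 p q (M : 'M[R]_(p, q)) : 0 <= opnorm M.
Proof.
apply: ub_le_sup; first by case: (opnorm_has_sup M).
by exists 0; rewrite /= ?mulmx0 norm20// ler01.
Qed.

Lemma bnd_opnorm p q (M : 'M[R]_(p, q)) : bnd (opnorm M) M.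
Proof.
apply/bndP; first exact: opnorm_ge0.
move=> v; have [v0|v0] := eqVneq (norm2 v) 0.
  by rewrite (norm2_eq0 v0) mulmx0 !norm20 mulr0.
have vp : 0 < norm2 v by rewrite lt_neqAle eq_sym v0 norm2_ge0.
rewrite -ler_pdivrMr//; apply: ub_le_sup; first by case: (opnorm_has_sup M).
exists ((norm2 v)^-1 *: v) => /=.
  by rewrite norm2Z ger0_norm ?invr_ge0 ?norm2_ge0// mulVf.
by rewrite -scalemxAr norm2Z ger0_norm ?invr_ge0 ?norm2_ge0// mulrC.
Qed.

Lemma opnorm_le p q c (M : 'M[R]_(p, q)) : 0 <= c -> bnd c M -> opnorm M <= c.
Proof.
move=> c0 /(bndP _ c0) H; apply: ge_sup; first by case: (opnorm_has_sup M).
by move=> _ [v /= v1 <-]; apply: le_trans (H v) _; rewrite ler_piMr.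
Qed.

(** Polarization: 4 [bil M u v] is the difference of the form at u + v and u - v, and the
    parallelogram law bounds it. Rescaling u and v to unit length then loses no factor, so the
    constant stays c. *)
Lemma bnd_quad n c (M : 'M[R]_n) : M^T = M ->
  (forall v, `|quad M v| <= c * norm2 v ^+ 2) -> bnd c M.
Proof.
move=> sM H.
have parallelogram u v : `|bil M u v| <= c / 2 * (norm2 u ^+ 2 + norm2 v ^+ 2).
  have := H (u + v); have := H (u - v); rewrite -!bil1 -!quadE.
  rewrite -scaleN1r !quadD ?trmx1// !bilZr !quadZ.
  rewrite !ler_norml => /andP[? ?] /andP[? ?].
  by apply/andP; split; lra.
move=> u v.
have [u0|u0] := eqVneq (norm2 u) 0.
  by rewrite u0 (norm2_eq0 u0) -(scale0r 0) bilZl mul0r normr0 mul0r mulr0.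
have [v0|v0] := eqVneq (norm2 v) 0.
  by rewrite v0 (norm2_eq0 v0) -(scale0r 0) bilZr mul0r normr0 mulr0 mulr0.
have up : 0 < norm2 u by rewrite lt_neqAle eq_sym u0 norm2_ge0.
have vp : 0 < norm2 v by rewrite lt_neqAle eq_sym v0 norm2_ge0.
have := parallelogram ((norm2 u)^-1 *: u) ((norm2 v)^-1 *: v).
rewrite bilZl bilZr !normrM !norm2Z !normfV !(ger0_norm (norm2_ge0 _)).
rewrite (mulVf u0) (mulVf v0).
rewrite expr1n mulrA -invfM mulrC ler_pdivrMr ?mulr_gt0//.
by rewrite (_ : c / 2 * (1 + 1) = c)//; field.
Qed.

End BoundedMatrices.

(** * Lyapunov equations *)

Section Lyapunov.
Context {R : realType}.

Definition decay n (C r : R) (L : 'M[R]_n) : Prop :=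
  [/\ 0 <= C, 0 <= r < 1 & forall k, bnd (C * r ^+ k) (L ^+ k)].

(** The series solving a Lyapunov equation is never formed: it is truncated at k, and this lemma
    discards the remainder. *)
Lemma ler_geometric_tail (a b D s : R) : 0 <= s < 1 ->
  (forall k, a <= b + D * s ^+ k) -> a <= b.
Proof.
move=> /andP[s0 s1] H.
have cvgs : (fun k => b + D * s ^+ k) @ \oo --> b.
  rewrite -[X in _ --> X]addr0 -[X in _ + X](mulr0 D).
  apply: cvgD; first exact: cvg_cst.
  by apply: cvgMl_tmp; apply: cvg_expr; rewrite ger0_norm.
rewrite -(cvg_lim _ cvgs)//; apply: limr_ge; first by apply/cvg_ex; exists b.
by near=> k; exact: H.
Unshelve. all: by end_near. Qed.

Lemma geometric_sum_le (s : R) k : 0 <= s < 1 -> \sum_(i < k) s ^+ i <= (1 - s)^-1.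
Proof.
move=> /andP[s0 s1]; have s1' : 0 < 1 - s by rewrite subr_gt0.
rewrite -(ler_pM2l s1') mulfV ?gt_eqF//.
have := subrXX 1 s k; rewrite expr1n; under eq_bigr do rewrite expr1n mul1r.
by move=> <-; rewrite gerBl exprn_ge0.
Qed.

Lemma bnd_exists p q (M : 'M[R]_(p, q)) : exists2 c : R, 0 <= c & bnd c M.
Proof. by exists (opnorm M); [exact: opnorm_ge0|exact: bnd_opnorm]. Qed.

Section Decaying.
Variables (n : nat) (L : 'M[R]_n) (C r : R).
Hypothesis decayL : decay C r L.

Let C0 : 0 <= C. Proof. by case: decayL. Qed.
Let r01 : 0 <= r < 1. Proof. by case: decayL. Qed.
Let r0 : 0 <= r. Proof. by case/andP: r01. Qed.
Let rr01 : 0 <= r ^+ 2 < 1.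
Proof. by case/andP: r01 => *; rewrite exprn_ge0// expr_lt1. Qed.

Lemma norm2_pow k u : norm2 (L ^+ k *m u) <= C * r ^+ k * norm2 u.
Proof.
have Cr0 : 0 <= C * r ^+ k by rewrite mulr_ge0// exprn_ge0.
by case: decayL => _ _ /(_ k)/(bndP _ Cr0); exact.
Qed.

Lemma bil_pow_le c (M : 'M[R]_n) u v k : 0 <= c -> bnd c M ->
  `|bil M (L ^+ k *m u) (L ^+ k *m v)| <=
  c * C ^+ 2 * (norm2 u * norm2 v) * (r ^+ 2) ^+ k.
Proof.
move=> c0 /(_ (L ^+ k *m u) (L ^+ k *m v)) /le_trans; apply.
rewrite -!mulrA ler_wpM2l//.
apply: le_trans (ler_pM _ _ (norm2_pow k u) (norm2_pow k v)) _; rewrite ?norm2_ge0//.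
by rewrite le_eqVlt -exprM mulnC exprM; apply/orP; left; apply/eqP; ring.
Qed.

Lemma lyapunov_unroll (X M : 'M[R]_n) u v k : X = L^T *m X *m L + M ->
  bil X u v = \sum_(i < k) bil M (L ^+ i *m u) (L ^+ i *m v)
              + bil X (L ^+ k *m u) (L ^+ k *m v).
Proof.
move=> XE; elim: k => [|k IH]; first by rewrite big_ord0 add0r expr0 !mul1mx.
rewrite IH big_ord_recr/= -addrA; congr (_ + _).
rewrite {1}XE bilMD addrC bil_mulmr bil_mulml; congr (_ + _).
by rewrite exprS -!mulmxE !mulmxA.
Qed.

(** Unroll the equation k times. The partial sums are geometric with ratio r^2, while the a priori
    bound on X appears only in the remainder and so leaves no trace in the result. *)
Lemma lyapunov_bnd (X M : 'M[R]_n) (c : R) : X = L^T *m X *m L + M -> 0 <= c -> bnd c M ->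
  bnd (c * C ^+ 2 / (1 - r ^+ 2)) X.
Proof.
move=> XE c0 bM u v.
have [x x0 bX] := bnd_exists X.
apply: (@ler_geometric_tail _ _ (x * C ^+ 2 * (norm2 u * norm2 v)) (r ^+ 2)) => // k.
rewrite (lyapunov_unroll u v k XE); apply: le_trans (ler_normD _ _) _.
apply: lerD; last exact: bil_pow_le.
apply: le_trans (ler_norm_sum _ _ _) _.
apply: (@le_trans _ _ (\sum_(i < k) c * C ^+ 2 * (norm2 u * norm2 v) * (r ^+ 2) ^+ i)).
  by apply: ler_sum => i _; exact: bil_pow_le.
rewrite -mulr_sumr [leRHS]mulrAC ler_wpM2l ?geometric_sum_le//.
by rewrite !mulr_ge0 ?norm2_ge0// exprn_ge0.
Qed.

(** The difference solves the equation with zero forcing term, to which [lyapunov_bnd] assigns the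
    bound 0. *)
Lemma lyapunov_uniq (X Y M : 'M[R]_n) :
  X = L^T *m X *m L + M -> Y = L^T *m Y *m L + M -> X = Y.
Proof.
move=> XE YE; apply/eqP; rewrite -subr_eq0; apply/eqP/matrixP => i j.
have /lyapunov_bnd/(_ (lexx 0)) H : X - Y = L^T *m (X - Y) *m L + 0.
  by rewrite {1}XE {1}YE mulmxBr mulmxBl addr0 opprD addrACA subrr addr0.
have /H bXY : bnd 0 (0 : 'M[R]_n).
  by move=> u v; rewrite /bil mulmx0 mul0mx mxE normr0 mul0r.
apply/eqP; rewrite [X in _ == X]mxE -normr_le0.
by have := entry_le_bnd i j bXY; rewrite !mul0r.
Qed.

Lemma lyapunov_quad_ge (X M : 'M[R]_n) v : X = L^T *m X *m L + M ->
  (forall v, 0 <= quad M v) -> quad M v <= quad X v.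
Proof.
move=> XE M0; rewrite -subr_ge0.
have [x x0 bX] := bnd_exists X.
(* Unrolling k + 1 times makes the sum nonempty, so that its first term [quad M v] can be split off;
   the other terms are nonnegative. *)
apply: (@ler_geometric_tail _ _ (x * C ^+ 2 * r ^+ 2 * (norm2 v * norm2 v)) (r ^+ 2)) => // k.
rewrite !quadE (lyapunov_unroll v v k.+1 XE) big_ord_recl/= expr0 !mul1mx.
rewrite [X in _ <= X + _]addrC -!addrA addKr.
apply: addr_ge0; first by apply: sumr_ge0 => i _; exact: M0.
rewrite -lerBlDr sub0r lerNl.
apply: le_trans (ler_norm _) _; rewrite normrN.
apply: le_trans (bil_pow_le _ _ _ x0 bX) _.
by rewrite [(_ ^+ 2) ^+ k.+1]exprS le_eqVlt; apply/orP; left; apply/eqP; ring.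
Qed.

End Decaying.

(** The matrix of X |-> X - L^T X L acting on row vectors [mxvec X]. *)
Definition lyap_mx n (L : 'M[R]_n) : 'M[R]_(n * n) :=
  1%:M - lin_mulmx L^T *m lin_mulmxr L.

(** A total function, linear in M for every L; it solves the Lyapunov equation once L decays
    ([lyapE]), because uniqueness then makes [lyap_mx L] injective, hence invertible. *)
Definition lyap n (L M : 'M[R]_n) : 'M[R]_n :=
  vec_mx (mxvec M *m invmx (lyap_mx L)).

Lemma mul_lyap_mx n (L X : 'M[R]_n) :
  mxvec X *m lyap_mx L = mxvec (X - L^T *m X *m L).
Proof.
by rewrite mulmxBr mulmx1 mulmxA !mul_vec_lin linearB.
Qed.

Lemma lyapE n (L M : 'M[R]_n) C r : decay C r L ->
  lyap L M = L^T *m lyap L M *m L + M.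
Proof.
move=> dL.
have uL : lyap_mx L \in unitmx.
  rewrite -row_free_unit; apply: inj_row_free => v.
  rewrite -(vec_mxK v) mul_lyap_mx => /eqP.
  rewrite -(linear0 mxvec) (inj_eq (can_inj mxvecK)) subr_eq0 => /eqP vE.
  rewrite (@lyapunov_uniq _ _ _ _ dL (vec_mx v) 0 0) ?linear0//.
    by rewrite addr0.
  by rewrite mul0mx addr0.
apply/eqP; rewrite addrC -subr_eq; apply/eqP/(can_inj mxvecK).
by rewrite -mul_lyap_mx vec_mxK mulmxKV.
Qed.

Lemma lyapD n (L M N : 'M[R]_n) : lyap L (M + N) = lyap L M + lyap L N.
Proof. by rewrite /lyap !linearD/= mulmxDl linearD. Qed.

Lemma lyapZ n (L M : 'M[R]_n) a : lyap L (a *: M) = a *: lyap L M.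
Proof. by rewrite /lyap !linearZ/= -scalemxAl linearZ. Qed.

Lemma lyap0 n (L : 'M[R]_n) : lyap L 0 = 0.
Proof. by rewrite -(scale0r 0) lyapZ !scale0r. Qed.

Lemma lyap_sum n (L : 'M[R]_n) (I : Type) (s : seq I) (F : I -> 'M[R]_n) :
  lyap L (\sum_(i <- s) F i) = \sum_(i <- s) lyap L (F i).
Proof.
by elim: s => [|i s IH]; rewrite ?big_nil ?lyap0// !big_cons lyapD IH.
Qed.

Lemma lyap_sym n (L M : 'M[R]_n) C r : decay C r L -> M^T = M ->
  (lyap L M)^T = lyap L M.
Proof.
move=> dL sM; apply: (lyapunov_uniq dL (M := M)); last exact: lyapE dL.
by rewrite {1}(lyapE M dL) linearD/= !trmx_mul trmxK sM mulmxA.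
Qed.

Lemma mxtrace_quad n (M : 'M[R]_n) : \tr M = \sum_i quad M (delta_mx i 0).
Proof. by apply: eq_bigr => i _; rewrite quadE bil_delta. Qed.

End Lyapunov.

(** * Geometric decay below spectral radius one *)

Section SpectralRadius.
Context {R : realType}.
Local Notation C := R[i].
Local Notation normc := ComplexField.Normc.normc.

Lemma normc_ge0 (z : C) : 0 <= normc z.
Proof. by case: z => a b; exact: sqrtr_ge0. Qed.

Lemma normcD (y z : C) : normc (y + z) <= normc y + normc z.
Proof.
by have := ler_normD y z; rewrite !normc_def -rmorphD lecR; case: y z => [? ?] [? ?].
Qed.

Section Annihilation.
Variables (n : nat) (M : 'M[C]_n.+1) (mu r : R).
Hypotheses (mu0 : 0 <= mu) (mur : mu < r).

Let geometric (q : {poly C}) : Prop := exists2 c : R, 0 <= c &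
  forall k i j, normc ((horner_mx M q *m M ^+ k) i j) <= c * r ^+ k.

(* With v_k = q(M) M^k and w_k = q(M) (M - z) M^k, one has v_(k+1) = z v_k + w_k, and
   |z| <= mu < r. *)
Lemma geometric_step (q : {poly C}) (z : C) : normc z <= mu ->
  geometric (q * ('X - z%:P)) -> geometric q.
Proof.
move=> zmu [c c0 Hc].
have r0 : 0 <= r by exact: le_trans mu0 (ltW mur).
pose v k i j := (horner_mx M q *m M ^+ k) i j.
pose w k i j := (horner_mx M (q * ('X - z%:P)) *m M ^+ k) i j.
have vS k i j : v k.+1 i j = z * v k i j + w k i j.
  rewrite /v /w rmorphM/= rmorphB/= horner_mx_X horner_mx_C exprS -mulmxE.
  rewrite mulmxBr mulmxBl -!mulmxA mul_scalar_mx -scalemxAr.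
  by rewrite [X in _ = _ + X]mxE [X in _ = _ + (_ + X)]mxE [X in _ - X]mxE addrC subrK.
pose V := \sum_i \sum_j normc (v 0%N i j).
have vV i j : normc (v 0%N i j) <= V.
  rewrite /V (bigD1 i)//= (bigD1 j)//= -addrA lerDl addr_ge0 ?sumr_ge0// => *.
    exact: normc_ge0.
  by rewrite sumr_ge0// => *; exact: normc_ge0.
have V0 : 0 <= V by apply: le_trans (vV 0 0); exact: normc_ge0.
have d0 : 0 < r - mu by rewrite subr_gt0.
have cd0 : 0 <= c / (r - mu) by rewrite divr_ge0// ltW.
(* The constant that closes the induction: with e = c / (r - mu) one has mu (V + e) + c = r (V + e)
   - (r - mu) V. *)
exists (V + c / (r - mu)); first by rewrite addr_ge0.
move=> k i j; rewrite -/(v k i j); elim: k => [|k IH].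
  by rewrite expr0 mulr1; apply: le_trans (vV i j) _; rewrite lerDl.
rewrite vS; apply: le_trans (normcD _ _) _; rewrite ComplexField.Normc.normcM.
apply: (@le_trans _ _ (mu * ((V + c / (r - mu)) * r ^+ k) + c * r ^+ k)).
  by rewrite lerD ?ler_pM ?normc_ge0//; exact: Hc.
have cE : c = c / (r - mu) * (r - mu) by rewrite mulfVK// gt_eqF.
set e := c / (r - mu) in cE cd0 *; rewrite {}cE -subr_ge0.
rewrite (_ : _ - _ = V * (r - mu) * r ^+ k); last by rewrite exprS; ring.
by rewrite !mulr_ge0 ?exprn_ge0// ltW.
Qed.

(* By Cayley-Hamilton the eigenvalues of M can be used for s; the linear factors are
   then removed one at a time. *)
Lemma geometric_powers (s : seq C) : (forall z, z \in s -> normc z <= mu) ->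
  horner_mx M (\prod_(z <- s) ('X - z%:P)) = 0 ->
  exists2 c : R, 0 <= c & forall k i j, normc ((M ^+ k) i j) <= c * r ^+ k.
Proof.
have r0 : 0 <= r by exact: le_trans mu0 (ltW mur).
move=> smu Ms; suff : geometric 1.
  case=> c c0 H; exists c => // k i j.
  by have := H k i j; rewrite rmorph1 mul1mx.
have : geometric (1 * \prod_(z <- s) ('X - z%:P)).
  rewrite mul1r /geometric Ms; exists 0 => // k i j.
  by rewrite mul0mx mxE mul0r ComplexField.Normc.normc0.
elim/last_ind: s smu {Ms} => [|s z IH] smu; first by rewrite big_nil mulr1.
rewrite -cats1 big_cat/= big_seq1 mulrA => /geometric_step H.
apply: IH => [y ys|]; first by apply: smu; rewrite mem_rcons inE ys orbT.
by apply: H; apply: smu; rewrite mem_rcons inE eqxx.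
Qed.

End Annihilation.

(** Over the complex numbers the characteristic polynomial splits and annihilates the matrix. The
    gap between the spectral radius and r absorbs the polynomial growth due to repeated
    eigenvalues. *)
Lemma spectral_radius_decay n (L : 'M[R]_n) : spectral_radius L < 1 ->
  exists c r, decay c r L.
Proof.
case: n L => [|n] L rho1.
  exists 0, 0; split; rewrite ?lexx ?ltr01// => k u v.
  rewrite (_ : bil _ u v = 0) ?normr0 ?mulr_ge0 ?norm2_ge0//.
  by rewrite /bil mxE big_ord0.
pose M := map_mx (real_complex R) L.
have [s charE] := closed_field_poly_normal (char_poly M).
rewrite (monicP (char_poly_monic M)) scale1r in charE.
have eigs z : eigenvalue M z = (z \in s).
  by rewrite eigenvalue_root_char charE root_prod_XsubC.
(* The maximum with 0 provides nonnegativity directly. The supremum bounds every root because the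
   spectrum is finite. *)
pose mu := Num.max 0 (spectral_radius L).
have mu1 : mu < 1 by rewrite gt_max ltr01.
have mu0 : 0 <= mu by rewrite le_max lexx.
have smu z : z \in s -> normc z <= mu.
  move=> zs; rewrite le_max; apply/orP; right.
  apply: ub_le_sup; last by exists z => //=; rewrite eigs.
  exists (\sum_(y <- s) normc y) => _ [y /= ys <-].
  rewrite eigs in ys; rewrite (big_rem y)//= lerDl sumr_ge0// => *.
  exact: normc_ge0.
pose r := (mu + 1) / 2.
have mur : mu < r by rewrite /r; lra.
have Ms : horner_mx M (\prod_(z <- s) ('X - z%:P)) = 0.
  by rewrite -charE Cayley_Hamilton.
have [c c0 Hc] := geometric_powers mu0 mur smu Ms.
exists (\sum_(i < n.+1) \sum_(j < n.+1) c), r; split.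
- by rewrite sumr_ge0// => *; rewrite sumr_ge0.
- by rewrite /r; apply/andP; split; lra.
move=> k; apply: bnd_le (bnd_entries _); rewrite mulr_suml ler_sum// => i _.
rewrite mulr_suml ler_sum// => j _.
have := Hc k i j; rewrite -rmorphXn/= mxE /real_complex_def/=.
by rewrite expr0n/= addr0 sqrtr_sqr.
Qed.

End SpectralRadius.

(** * Riccati equations *)

Section PositiveMatrices.
Context {R : realType}.

Lemma sym_quad0 n (M : 'M[R]_n) : M^T = M -> (forall v, quad M v = 0) -> M = 0.
Proof.
move=> sM M0; apply/matrixP => i j; apply/eqP; rewrite [X in _ == X]mxE -normr_le0.
by apply: entry_le_bnd; apply: bnd_quad => // v; rewrite M0 normr0 mul0r.
Qed.

Lemma quad_congr p q (M : 'M[R]_p) (L : 'M[R]_(p, q)) v :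
  quad (L^T *m M *m L) v = quad M (L *m v).
Proof. by rewrite !quadE bil_mulmr bil_mulml. Qed.

Lemma possemidef_congr p q (M : 'M[R]_p) (L : 'M[R]_(p, q)) :
  possemidef M -> possemidef (L^T *m M *m L).
Proof.
by move=> [sM M0]; split=> [|v]; rewrite ?quad_congr// !trmx_mul trmxK sM mulmxA.
Qed.

Lemma possemidefD n (M N : 'M[R]_n) : possemidef M -> possemidef N ->
  possemidef (M + N).
Proof.
move=> [sM M0] [sN N0]; split=> [|v]; first by rewrite linearD/= sM sN.
by rewrite quadE bilMD addr_ge0// -quadE.
Qed.

Lemma posdef_semi n (M : 'M[R]_n) : posdef M -> possemidef M.
Proof.
move=> [sM M0]; split=> // v; have [->|/M0/ltW//] := eqVneq v 0.
by rewrite quadE /bil mulmx0 mxE.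
Qed.

(** That is, M is at least I / c, written without division. With a fixed c this survives convex
    combinations and the addition of positive semidefinite terms, so a single [iota] controls the
    inverses of all matrices R_w + B^T P B. *)
Definition coercive n (c : R) (M : 'M[R]_n) : Prop :=
  M^T = M /\ forall v, norm2 v ^+ 2 <= c * quad M v.

Lemma coercive_unit n c (M : 'M[R]_n) : coercive c M -> M \in unitmx.
Proof.
move=> [sM cM]; rewrite -row_free_unit; apply: inj_row_free => v vM.
apply: trmx_inj; rewrite linear0; apply: norm2_eq0; apply/eqP.
rewrite -[_ == 0]sqrf_eq0 eq_le sqr_ge0 andbT; apply: le_trans (cM _) _.
by rewrite /quad trmxK vM mul0mx mxE mulr0.
Qed.

Lemma coercive_inv n c (M : 'M[R]_n) : 0 <= c -> coercive c M -> bnd c (invmx M).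
Proof.
move=> c0 cM; apply/bndP => // u; set v := invmx M *m u.
have [->|v0] := eqVneq (norm2 v) 0; first by rewrite mulr_ge0// norm2_ge0.
have vp : 0 < norm2 v by rewrite lt_neqAle eq_sym v0 norm2_ge0.
rewrite -(ler_pM2l vp) -expr2; apply: le_trans (cM.2 v) _.
rewrite mulrCA ler_wpM2l// quadE -(mul1mx M) bil_mulmr mulmxA mulmxV ?(coercive_unit cM)//.
by rewrite mul1mx; apply: le_trans (ler_norm _) (ler_dot _ _).
Qed.

Lemma posdef_unit n (M : 'M[R]_n) : posdef M -> M \in unitmx.
Proof.
move=> [sM M0]; rewrite -row_free_unit; apply: inj_row_free => v vM.
apply: trmx_inj; rewrite linear0; apply/eqP; apply: contraT => /M0.
by rewrite /quad trmxK vM mul0mx mxE ltxx.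
Qed.

(* Cauchy-Schwarz for the inner product given by M, applied to v and M^-1 v. *)
Lemma posdef_coercive n c (M : 'M[R]_n) : posdef M -> opnorm (invmx M) <= c ->
  coercive c M.
Proof.
move=> pM Mc; split=> [|v]; first by case: pM.
have uM := posdef_unit pM.
have [sM M0] := posdef_semi pM.
have [->|v0] := eqVneq (norm2 v) 0.
  by rewrite expr0n mulr_ge0//; apply: le_trans Mc; exact: opnorm_ge0.
have vp : 0 < norm2 v by rewrite lt_neqAle eq_sym v0 norm2_ge0.
have v2 : 0 < norm2 v ^+ 2 by rewrite exprn_gt0.
have := bil_CauchySchwarz v (invmx M *m v) (conj sM M0).
rewrite !quadE -bil_mulmr mulmxV// bil1.
rewrite -{2}(mul1mx M) -(trmx1 R n) bil_mulml mul1mx -bil_mulmr.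
rewrite (_ : bil (M *m invmx M) _ _ = bil (invmx M) v v); last first.
  by rewrite mulmxV// -bilT trmx1 -bil_mulmr mul1mx.
move=> H; rewrite -(ler_pM2l v2) -expr2; apply: le_trans H _.
rewrite mulrC mulrCA mulrA ler_wpM2r// -?quadE//.
apply: le_trans (ler_norm _) _; apply: le_trans (bnd_opnorm _ _ _) _.
by rewrite -expr2 ler_wpM2r// ltW.
Qed.

End PositiveMatrices.

Section Riccati.
Context {R : realType} {n d : nat}.
Variables (A : 'M[R]_n) (B : 'M[R]_(n, d)).

Definition stage_cost (Q : 'M[R]_n) (Rc : 'M[R]_d) (K : 'M[R]_(d, n)) : 'M[R]_n :=
  Q + K^T *m Rc *m K.

Definition gain (Rc : 'M[R]_d) (P : 'M[R]_n) : 'M[R]_(d, n) :=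
  - (invmx (Rc + B^T *m P *m B) *m B^T *m P *m A).

Definition riccati (Q : 'M[R]_n) (Rc : 'M[R]_d) (P : 'M[R]_n) : 'M[R]_n :=
  A^T *m P *m A
      - A^T *m P *m B *m invmx (Rc + B^T *m P *m B) *m B^T *m P *m A + Q.

(** The Bellman operator of the fixed gain K; [riccati] is the one that minimizes over gains. The
    fixed point of [backup] for a stabilizing K is its Lyapunov solution. *)
Definition backup (Q : 'M[R]_n) (Rc : 'M[R]_d) (K : 'M[R]_(d, n)) (P : 'M[R]_n) :=
  (A + B *m K)^T *m P *m (A + B *m K) + stage_cost Q Rc K.

Section FixedCost.
Variables (Q : 'M[R]_n) (Rc : 'M[R]_d) (iota : R).
Hypotheses (psdQ : possemidef Q) (psdR : possemidef Rc).
Hypotheses (iota0 : 0 <= iota) (cR : coercive iota Rc).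

Lemma possemidef_hess P : possemidef P -> possemidef (Rc + B^T *m P *m B).
Proof. by move=> psdP; apply: possemidefD => //; exact: possemidef_congr. Qed.

Lemma coercive_hess P : possemidef P -> coercive iota (Rc + B^T *m P *m B).
Proof.
move=> psdP; split=> [|v]; first by case: (possemidef_hess psdP).
apply: le_trans (cR.2 v) _; rewrite ler_wpM2l// [leRHS]quadE bilMD lerDl -quadE.
by rewrite quad_congr; case: psdP.
Qed.

Lemma possemidef_stage_cost K : possemidef (stage_cost Q Rc K).
Proof. by apply: possemidefD => //; exact: possemidef_congr. Qed.

(** As a function of K, [backup] is quadratic with Hessian S = R + B^T P B, and [gain] is its
    critical point. Expanding, S and its inverse cancel in the cross terms. *)
Lemma complete_square K P : possemidef P ->
  backup Q Rc K P = riccati Q Rc P +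
    (K - gain Rc P)^T *m (Rc + B^T *m P *m B) *m (K - gain Rc P).
Proof.
move=> psdP; have uS := coercive_unit (coercive_hess psdP).
have [sS _] := possemidef_hess psdP.
rewrite /backup /riccati /gain /stage_cost opprK.
set S := Rc + _ in uS sS *; set Si := invmx S.
have sSi : Si^T = Si by rewrite trmx_inv sS.
pose G := B^T *m P *m A.
have GT : A^T *m P *m B = G^T by rewrite /G !trmx_mul trmxK psdP.1 mulmxA.
have -> : Si *m B^T *m P *m A = Si *m G by rewrite !mulmxA.
have -> : A^T *m P *m B *m Si *m B^T *m P *m A = G^T *m Si *m G.
  by rewrite GT !mulmxA.
have GK : A^T *m P *m (B *m K) = G^T *m K by rewrite mulmxA GT.
have KG : K^T *m B^T *m P *m A = K^T *m G by rewrite /G !mulmxA.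
have KSK : K^T *m S *m K = K^T *m Rc *m K + K^T *m B^T *m P *m (B *m K).
  by rewrite /S !(mulmxDl, mulmxDr) !mulmxA.
have SSi : S *m Si = 1%:M by rewrite mulmxV.
have SiS : Si *m S = 1%:M by rewrite mulVmx.
clearbody Si G S.
rewrite !linearD/= !trmx_mul !(mulmxDl, mulmxDr) sSi GK KG KSK.
rewrite -[G^T *m Si *m S]mulmxA SiS mulmx1 !mulmxA -[_ *m S *m Si]mulmxA SSi mulmx1.
(* Both sides are now sums of these six products; abstracting them leaves an additive identity in
   each entry. *)
set t1 := A^T *m P *m A; set t2 := K^T *m G; set t3 := G^T *m K.
set t4 := K^T *m B^T *m P *m B *m K; set t5 := _ *m Rc *m K; set t6 := G^T *m Si *m G.
by apply/matrixP => i j; move: t1 t2 t3 t4 t5 t6 => t1 t2 t3 t4 t5 t6; rewrite !mxE; ring.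
Qed.

Lemma riccati_gain P : possemidef P -> riccati Q Rc P = backup Q Rc (gain Rc P) P.
Proof. by move=> psdP; rewrite complete_square// subrr mulmx0 addr0. Qed.

Lemma riccati_le_backup K P v : possemidef P ->
  quad (riccati Q Rc P) v <= quad (backup Q Rc K P) v.
Proof.
move=> psdP; rewrite (complete_square K)// [leRHS]quadE bilMD lerDl -quadE.
by rewrite quad_congr; case: (possemidef_hess psdP).
Qed.

Lemma quad_backup K P v : quad (backup Q Rc K P) v =
  quad P ((A + B *m K) *m v) + quad (stage_cost Q Rc K) v.
Proof. by rewrite /backup !quadE bilMD -!quadE quad_congr. Qed.

Lemma possemidef_riccati P : possemidef P -> possemidef (riccati Q Rc P).
Proof.
move=> psdP; rewrite riccati_gain//; apply: possemidefD.
  exact: possemidef_congr.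
exact: possemidef_stage_cost.
Qed.

(** The greedy gain of Y is a candidate for X: [riccati] at X is below [backup] at X with that gain,
    which is below [backup] at Y with the same gain, and this is [riccati] at Y. *)
Lemma riccati_mono X Y v : possemidef X -> possemidef Y ->
  (forall v, quad X v <= quad Y v) ->
  quad (riccati Q Rc X) v <= quad (riccati Q Rc Y) v.
Proof.
move=> psdX psdY XY; rewrite (riccati_gain psdY).
by apply: le_trans (riccati_le_backup (gain Rc Y) v psdX) _; rewrite !quad_backup lerD2r.
Qed.

Lemma gain_bnd a b p P : 0 <= a -> 0 <= b -> 0 <= p -> bnd a A -> bnd b B ->
  possemidef P -> bnd p P -> bnd (iota * b * p * a) (gain Rc P).
Proof.
move=> a0 b0 p0 bA bB psdP bP; apply: bndN.
apply: bndM; rewrite ?mulr_ge0//; apply: bndM; rewrite ?mulr_ge0//.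
apply: bndM => //; last exact: bndT.
exact: coercive_inv (coercive_hess psdP).
Qed.

Lemma hess_gain P : possemidef P ->
  (Rc + B^T *m P *m B) *m gain Rc P = - (B^T *m P *m A).
Proof.
move=> psdP; have uS := coercive_unit (coercive_hess psdP).
by rewrite /gain mulmxN !mulmxA mulmxV// mul1mx.
Qed.

(** Performance difference formula: the excess cost of K over P is the accumulated squared gain
    error. By [complete_square] both sides solve the same Lyapunov equation; only the closed loop of
    K has to decay. *)
Lemma riccati_fix_lyap K P C r : possemidef P -> P = riccati Q Rc P ->
  decay C r (A + B *m K) ->
  lyap (A + B *m K) (stage_cost Q Rc K) =
  P + lyap (A + B *m K)
        ((K - gain Rc P)^T *m (Rc + B^T *m P *m B) *m (K - gain Rc P)).
Proof.
move=> psdP PE dK; apply: (lyapunov_uniq dK (M := stage_cost Q Rc K)).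
  exact: lyapE dK.
have := complete_square K psdP; rewrite -PE /backup.
move: (_^T *m _ *m (K - gain Rc P)) => D; move: (A + B *m K) dK => L dL sq.
rewrite mulmxDr mulmxDl {1}(lyapE D dL) addrCA addrA addrC addrA -addrA.
by rewrite addrCA [D + P]addrC -sq addrA [X in X + _]addrC.
Qed.

End FixedCost.
End Riccati.

(** * Solvability of the Riccati equation by value iteration *)

Lemma ler_vanishing {R : realType} (e : nat -> R) (a b D : R) :
  e @ \oo --> (0 : R) -> (\forall k \near \oo, a <= b + D * e k) -> a <= b.
Proof.
move=> e0 H.
have cvgs : (fun k => b + D * e k) @ \oo --> b.
  rewrite -[X in _ --> X]addr0 -[X in _ + X](mulr0 D).
  by apply: cvgD; [exact: cvg_cst|exact: cvgMl_tmp].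
rewrite -(cvg_lim _ cvgs)//; apply: limr_ge => //.
by apply/cvg_ex; exists b.
Qed.

Section MonotoneConvergence.
Context {R : realType} {n : nat}.
Variables (P : nat -> 'M[R]_n) (x : R).
Hypotheses (symP : forall k, (P k)^T = P k).
Hypotheses (incP : forall k v, quad (P k) v <= quad (P k.+1) v).
Hypotheses (ubP : forall k v, quad (P k) v <= x * norm2 v ^+ 2).

(** By polarization every entry is a combination of three values of the form, each a bounded
    monotone sequence. The errors e k are stated as norm bounds because [dare_exists] applies them
    at vectors that vary with k. *)
Lemma monotone_bounded_cvg : exists (M : 'M[R]_n) (e : nat -> R),
  [/\ M^T = M, e @ \oo --> (0 : R), forall k, 0 <= e k &
    forall k, bnd (e k) (M - P k)].
Proof.
have cq v : cvgn (fun k => quad (P k) v).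
  apply: nondecreasing_is_cvgn.
    by apply/nondecreasing_seqP => k; exact: incP.
  by exists (x * norm2 v ^+ 2) => _ [k _ <-]; exact: ubP.
have entry k i j : P k i j = 2^-1 * (quad (P k) (delta_mx i 0 + delta_mx j 0)
    - quad (P k) (delta_mx i 0) - quad (P k) (delta_mx j 0)).
  by rewrite quadD// -bil_delta; field.
have ce i j : cvgn (fun k => P k i j).
  apply/cvg_ex; eexists.
  under eq_cvg do rewrite entry.
  by apply: cvgMl_tmp; apply: cvgB; [apply: cvgB|]; exact: cq.
pose M := \matrix_(i, j) limn (fun k => P k i j).
exists M, (fun k => \sum_i \sum_j `|(M - P k) i j|); split.
- apply/matrixP => i j; rewrite !mxE; congr (limn _); apply/funext => k.
  by rewrite -{1}(symP k) mxE.
- rewrite [X in _ --> X](_ : _ = \sum_(i < n) \sum_(j < n) `|M i j - M i j|).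
    apply: cvg_big => [|i _]; first exact: add_continuous.
    apply: cvg_big => [|j _]; first exact: add_continuous.
    apply: cvg_norm; under eq_cvg do rewrite !mxE.
    by apply: cvgB; [rewrite [M i j]mxE; exact: cvg_cst|rewrite mxE; exact: ce].
  by rewrite big1// => i _; rewrite big1// => j _; rewrite subrr normr0.
- by move=> k; rewrite sumr_ge0// => i _; rewrite sumr_ge0.
- by move=> k; exact: bnd_entries.
Qed.

End MonotoneConvergence.

Section DareExistence.
Context {R : realType} {n d : nat}.
Variables (A : 'M[R]_n) (B : 'M[R]_(n, d)).
Variables (Q : 'M[R]_n) (Rc : 'M[R]_d) (iota : R).
Hypotheses (psdQ : possemidef Q) (psdR : possemidef Rc).
Hypotheses (iota0 : 0 <= iota) (cR : coercive iota Rc).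

Let value_iter k := iter k (riccati A B Q Rc) 0.

Lemma possemidef_value_iter k : possemidef (value_iter k).
Proof.
elim: k => [|k IH]; last exact: (possemidef_riccati _ _ psdQ psdR iota0 cR).
by split=> [|v]; rewrite ?linear0// /quad mulmx0 mul0mx mxE.
Qed.

Lemma value_iter_inc k v : quad (value_iter k) v <= quad (value_iter k.+1) v.
Proof.
elim: k v => [|k IH] v.
  by rewrite [leLHS](_ : _ = 0) ?(possemidef_value_iter 1).2// /quad mulmx0 mul0mx mxE.
exact: (riccati_mono _ _ _ psdR iota0 cR _ (possemidef_value_iter k)
  (possemidef_value_iter k.+1)).
Qed.

Lemma value_iter_le K X k v : possemidef X -> X = backup A B Q Rc K X ->
  quad (value_iter k) v <= quad X v.
Proof.
move=> psdX XE; elim: k v => [|k IH] v.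
  by rewrite [leLHS](_ : _ = 0) ?psdX.2// /quad mulmx0 mul0mx mxE.
apply: le_trans (riccati_le_backup _ _ _ psdR iota0 cR K v (possemidef_value_iter k)) _.
by rewrite XE !quad_backup lerD2r.
Qed.

(* Value iteration from 0 increases and is dominated by the value X of a stabilizing
   gain, so it converges; the limit solves the Riccati equation. *)
Lemma dare_exists : stabilizable A B -> exists P, dare_solution A B Q Rc P.
Proof.
case=> K0 /spectral_radius_decay[c [r dK]].
have psdM := possemidef_stage_cost psdQ psdR K0.
pose X := lyap (A + B *m K0) (stage_cost Q Rc K0).
have XE : X = backup A B Q Rc K0 X by exact: lyapE dK.
have psdX : possemidef X.
  split=> [|v]; first by apply: lyap_sym dK _; case: psdM.
  by apply: le_trans (lyapunov_quad_ge dK v XE psdM.2); case: psdM.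
have [x x0 bX] := bnd_exists X.
have [a a0 bA] := bnd_exists A; have [b b0 bB] := bnd_exists B.
have ubP k v : quad (value_iter k) v <= x * norm2 v ^+ 2.
  apply: le_trans (value_iter_le k v psdX XE) _.
  by apply: le_trans (ler_norm _) _; rewrite quadE expr2; exact: bX.
have [P [e [symP e0 e_ge0 bD]]] := monotone_bounded_cvg
  (fun k => (possemidef_value_iter k).1) value_iter_inc ubP.
have quadD_le k v : `|quad (P - value_iter k) v| <= norm2 v ^+ 2 * e k.
  by rewrite quadE mulrC expr2; exact: bD.
have P_ge k v : quad (value_iter k) v <= quad P v.
  apply: (ler_vanishing (D := norm2 v ^+ 2) e0); near=> j.
  have kj : (k <= j)%N by near: j; exact: nbhs_infty_ge.
  apply: (@le_trans _ _ (quad (value_iter j) v)).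
    have /nondecreasing_seqP inc i : quad (value_iter i) v <= quad (value_iter i.+1) v.
      exact: value_iter_inc.
    exact: inc.
  have := quadD_le j v; rewrite quadE bilMB -!quadE ler_norml => /andP[+ _].
  by rewrite lerNl opprB lerBlDl addrC.
have psdP : possemidef P.
  by split=> // v; apply: le_trans (P_ge 0%N v); case: (possemidef_value_iter 0).
have psdric := possemidef_riccati A B psdQ psdR iota0 cR psdP.
exists P; split=> //; rewrite -/(riccati A B Q Rc P).
apply/eqP; rewrite -subr_eq0; apply/eqP/sym_quad0.
  by rewrite linearB/= symP psdric.1.
move=> v; rewrite quadE bilMB -!quadE; apply/eqP; rewrite subr_eq0 eq_le.
apply/andP; split.
  (* P <= P_k + e_k <= P_(k+1) + e_k, and P_(k+1) = riccati P_k <= riccati P by monotonicity. *)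
  apply: (ler_vanishing (D := norm2 v ^+ 2) e0); near=> k.
  apply: (@le_trans _ _ (quad (value_iter k.+1) v + norm2 v ^+ 2 * e k)).
    have := quadD_le k v; rewrite quadE bilMB -!quadE ler_norml => /andP[_].
    rewrite lerBlDl => /le_trans; apply; rewrite lerD2r; exact: value_iter_inc.
  rewrite lerD2r; apply: (riccati_mono _ _ _ psdR iota0 cR) => //.
  exact: possemidef_value_iter.
(* The greedy gains stay bounded, so they cannot amplify the error P - value_iter k. *)
pose K k := gain A B Rc (value_iter k).
pose kappa := iota * b * x * a.
have kappa0 : 0 <= kappa by rewrite !mulr_ge0.
have bP k : bnd x (value_iter k).
  apply: bnd_quad; first exact: (possemidef_value_iter k).1.
  by move=> u; rewrite ger0_norm ?(possemidef_value_iter k).2.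
have bK k : bnd kappa (K k).
  exact: (gain_bnd psdR iota0 cR a0 b0 x0 bA bB (possemidef_value_iter k) (bP k)).
have bL k : bnd (a + b * kappa) (A + B *m K k) by apply: bndD => //; exact: bndM.
set l := a + b * kappa in bL; have l0 : 0 <= l by rewrite addr_ge0 ?mulr_ge0.
(* riccati P is at most the backup of P with the greedy gain of P_k. That backup is P_(k+1) plus the
   error P - P_k seen through a closed loop of norm at most l, and P_(k+1) <= P. *)
apply: (ler_vanishing (D := l ^+ 2 * norm2 v ^+ 2) e0); near=> k.
apply: le_trans (riccati_le_backup _ _ _ psdR iota0 cR (K k) v psdP) _.
have -> : quad (backup A B Q Rc (K k) P) v =
    quad (backup A B Q Rc (K k) (value_iter k)) v +
    quad (P - value_iter k) ((A + B *m K k) *m v).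
  by rewrite !quad_backup !quadE bilMB; ring.
apply: lerD.
  rewrite -(riccati_gain _ _ _ psdR iota0 cR)//; first exact: (P_ge k.+1).
  exact: possemidef_value_iter.
apply: le_trans (ler_norm _) _; apply: le_trans (quadD_le _ _) _.
rewrite ler_wpM2r// -exprMn ler_pXn2r ?nnegrE ?norm2_ge0 ?mulr_ge0 ?norm2_ge0//.
by move: v; apply/bndP.
Unshelve. all: by end_near. Qed.
End DareExistence.

(** * Lipschitz dependence on the weight *)

Section SandwichDifferences.
Context {R : realType}.

Lemma sandwich_sub p q (Z : 'M[R]_p) (X Y : 'M[R]_(p, q)) :
  X^T *m Z *m X - Y^T *m Z *m Y = (X - Y)^T *m Z *m X + Y^T *m Z *m (X - Y).
Proof. by rewrite linearB/= !mulmxBl mulmxBr addrA subrK. Qed.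

Lemma lyapunov_sub n (X X' L L' M M' : 'M[R]_n) :
  X = L^T *m X *m L + M -> X' = L'^T *m X' *m L' + M' ->
  X - X' = L^T *m (X - X') *m L +
    ((L - L')^T *m X' *m L + L'^T *m X' *m (L - L') + (M - M')).
Proof.
move=> XE XE'; rewrite {1}XE {1}XE' -sandwich_sub mulmxBr mulmxBl opprD addrACA.
by rewrite [RHS]addrA [X in _ = X + _]addrA subrK.
Qed.

(** By [lyapunov_sub] the difference solves a Lyapunov equation for L, with X' only in the forcing
    term; so decay of L and a norm bound on X' suffice. *)
Lemma lyapunov_lipschitz n (X X' L L' M M' : 'M[R]_n) C r l x dl dm : decay C r L ->
  X = L^T *m X *m L + M -> X' = L'^T *m X' *m L' + M' ->
  0 <= l -> 0 <= x -> 0 <= dl -> 0 <= dm ->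
  bnd l L -> bnd l L' -> bnd x X' -> bnd dl (L - L') -> bnd dm (M - M') ->
  bnd ((dl * x * l + l * x * dl + dm) * (C ^+ 2 / (1 - r ^+ 2))) (X - X').
Proof.
move=> dL XE XE' l0 x0 dl0 dm0 bL bL' bX' bDL bDM; rewrite mulrA.
apply: (lyapunov_bnd dL (lyapunov_sub XE XE')).
  by rewrite !addr_ge0 ?mulr_ge0.
apply: bndD => //; apply: bndD.
  by apply: bndM; rewrite ?mulr_ge0//; apply: bndM => //; exact: bndT.
by apply: bndM; rewrite ?mulr_ge0//; apply: bndM => //; exact: bndT.
Qed.

Lemma stage_cost_lipschitz n d (Q : 'M[R]_n) (Rc : 'M[R]_d) K K' g k dk :
  0 <= g -> 0 <= k -> 0 <= dk -> bnd g Rc -> bnd k K -> bnd k K' -> bnd dk (K - K') ->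
  bnd (dk * g * k + k * g * dk) (stage_cost Q Rc K - stage_cost Q Rc K').
Proof.
move=> g0 k0 dk0 bR bK bK' bDK.
rewrite /stage_cost opprD addrACA subrr add0r sandwich_sub; apply: bndD.
  by apply: bndM; rewrite ?mulr_ge0//; apply: bndM => //; exact: bndT.
by apply: bndM; rewrite ?mulr_ge0//; apply: bndM => //; exact: bndT.
Qed.

(** Subtracting the normal equations S K = - B^T P A and S' K' = - B^T P' A gives S (K - K') = -
    (B^T (P - P') A + (S - S') K'). Only S is inverted, and no difference of inverses arises. *)
Lemma gain_lipschitz n d (A : 'M[R]_n) (B : 'M[R]_(n, d)) (Rc Rc' : 'M[R]_d)
    (P P' : 'M[R]_n) iota a b k p r :
  0 <= iota -> possemidef Rc -> possemidef Rc' ->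
  coercive iota Rc -> coercive iota Rc' -> possemidef P -> possemidef P' ->
  0 <= a -> 0 <= b -> 0 <= k -> 0 <= p -> 0 <= r -> bnd a A -> bnd b B ->
  bnd k (gain A B Rc' P') -> bnd p (P - P') -> bnd r (Rc - Rc') ->
  bnd (iota * (b * p * a + (r + b * p * b) * k)) (gain A B Rc P - gain A B Rc' P').
Proof.
move=> i0 psdR psdR' cR cR' psdP psdP' a0 b0 k0 p0 r0 bA bB bK bDP bDR.
have cS := coercive_hess B psdR i0 cR psdP.
have gE := hess_gain A B psdR i0 cR psdP.
have gE' := hess_gain A B psdR' i0 cR' psdP'.
set K := gain A B Rc P in gE *; set K' := gain A B Rc' P' in bK gE' *.
set S := Rc + _ in cS gE; set S' := Rc' + _ in gE'.
have SE : S - S' = (Rc - Rc') + B^T *m (P - P') *m B.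
  by rewrite mulmxBr mulmxBl opprD addrACA.
have -> : K - K' = - (invmx S *m
    (B^T *m (P - P') *m A + ((Rc - Rc') + B^T *m (P - P') *m B) *m K')).
  rewrite -[LHS]mul1mx -(mulVmx (coercive_unit cS)) -[LHS]mulmxA -mulmxN.
  rewrite -SE; congr (_ *m _); rewrite mulmxBr gE mulmxBl gE' mulmxBr mulmxBl.
  move: (B^T *m P *m A) (B^T *m P' *m A) (S *m _) => x y z.
  by apply/matrixP => i j; rewrite !mxE; ring.
apply: bndN; apply: bndM; rewrite ?addr_ge0 ?mulr_ge0 ?addr_ge0 ?mulr_ge0//.
  exact: coercive_inv.
have bBP : bnd (b * p) (B^T *m (P - P')) by apply: bndM => //; exact: bndT.
apply: bndD; first by apply: bndM; rewrite ?mulr_ge0.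
apply: bndM; rewrite ?addr_ge0 ?mulr_ge0//.
by apply: bndD => //; apply: bndM; rewrite ?mulr_ge0.
Qed.

End SandwichDifferences.

Section Scalarized.
Context {R : realType} {n d m : nat}.
Variables (A : 'M[R]_n) (B : 'M[R]_(n, d)).
Variables (Q : 'I_m -> 'M[R]_n) (Rc : 'I_m -> 'M[R]_d) (iota : R).
Hypotheses (psdQ : forall i, possemidef (Q i)) (psdR : forall i, possemidef (Rc i)).
Hypotheses (iota0 : 0 <= iota) (cR : forall i, coercive iota (Rc i)).

Lemma simplex_sum (w : 'rV[R]_m) : simplex m w -> \sum_i w 0 i = 1.
Proof. by move=> [w0 <-]; apply: eq_bigr => i _; rewrite ger0_norm. Qed.

Lemma possemidef_sum p (w : 'rV[R]_m) (F : 'I_m -> 'M[R]_p) :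
  (forall i, 0 <= w 0 i) -> (forall i, possemidef (F i)) ->
  possemidef (\sum_i w 0 i *: F i).
Proof.
move=> w0 psdF; split=> [|v].
  by rewrite linear_sum; apply: eq_bigr => i _; rewrite linearZ/= (psdF i).1.
rewrite quadE bilM_sum; apply: sumr_ge0 => i _.
by rewrite bilMZ mulr_ge0//; exact: (psdF i).2.
Qed.

Lemma possemidef_Qw w : simplex m w -> possemidef (Qw Q w).
Proof. by move=> [w0 _]; exact: possemidef_sum. Qed.

Lemma possemidef_Rw w : simplex m w -> possemidef (Rw Rc w).
Proof. by move=> [w0 _]; exact: possemidef_sum. Qed.

Lemma coercive_Rw w : simplex m w -> coercive iota (Rw Rc w).
Proof.
move=> sw; split=> [|v]; first by case: (possemidef_Rw sw).
rewrite quadE bilM_sum mulr_sumr -[leLHS]mul1r -(simplex_sum sw) mulr_suml.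
apply: ler_sum => i _; rewrite bilMZ [leRHS]mulrCA ler_wpM2l//; first by case: sw.
by case: (cR i).
Qed.

Lemma stage_cost_sum w K :
  stage_cost (Qw Q w) (Rw Rc w) K = \sum_i w 0 i *: stage_cost (Q i) (Rc i) K.
Proof.
rewrite /stage_cost /Qw /Rw mulmx_sumr mulmx_suml -big_split/=.
by apply: eq_bigr => i _; rewrite scalerDr -scalemxAr -scalemxAl.
Qed.

Lemma lyap_scalarized w K :
  lyap (A + B *m K) (stage_cost (Qw Q w) (Rw Rc w) K) =
  \sum_i w 0 i *: lyap (A + B *m K) (stage_cost (Q i) (Rc i) K).
Proof. by rewrite stage_cost_sum lyap_sum; apply: eq_bigr => i _; exact: lyapZ. Qed.

Hypothesis stab : stabilizable A B.

Lemma dare_Pw w : simplex m w ->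
  dare_solution A B (Qw Q w) (Rw Rc w) (Pw A B Q Rc w).
Proof.
move=> sw; apply: xgetPex.
exact: (dare_exists (possemidef_Qw sw) (possemidef_Rw sw) iota0 (coercive_Rw sw)).
Qed.

Lemma possemidef_Pw w : simplex m w -> possemidef (Pw A B Q Rc w).
Proof. by move=> /dare_Pw[]. Qed.

(** The excess is returned as a matrix D, so that the comparison can be read through quadratic forms
    ([Pw_sub_le]) or through traces ([Kw_optimal]). *)
Lemma Pw_le_lyap w K C r : simplex m w -> decay C r (A + B *m K) ->
  exists2 D, lyap (A + B *m K) (stage_cost (Qw Q w) (Rw Rc w) K) =
    Pw A B Q Rc w + D & forall v, 0 <= quad D v.
Proof.
move=> sw dK; have [psdP PE] := dare_Pw sw.
have psdS := possemidef_hess B (possemidef_Rw sw) psdP.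
eexists; first exact: (riccati_fix_lyap (possemidef_Rw sw) iota0 (coercive_Rw sw)
  psdP PE dK).
have [_ D0] := possemidef_congr (K - gain A B (Rw Rc w) (Pw A B Q Rc w)) psdS.
by move=> v; apply: le_trans (lyapunov_quad_ge dK v (lyapE _ dK) D0).
Qed.

Lemma lyap_Kw w C r : simplex m w -> decay C r (A + B *m Kw A B Q Rc w) ->
  lyap (A + B *m Kw A B Q Rc w) (stage_cost (Qw Q w) (Rw Rc w) (Kw A B Q Rc w)) =
  Pw A B Q Rc w.
Proof.
move=> sw dK; have [psdP PE] := dare_Pw sw.
rewrite (riccati_fix_lyap (possemidef_Rw sw) iota0 (coercive_Rw sw) psdP PE dK).
by rewrite subrr mulmx0 lyap0 addr0.
Qed.

Lemma simplex_le1 (w : 'rV[R]_m) i : simplex m w -> w 0 i <= 1.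
Proof.
move=> sw; rewrite -(simplex_sum sw) (bigD1 i)//= lerDl sumr_ge0// => j _.
by case: sw.
Qed.

(** Compare with one stabilizing K0 for all weights at once. Without such a bound the [sup] in
    [Pmax] and [Kmax] could be a default value that bounds nothing. *)
Lemma Pw_bounded : exists2 p : R, 0 <= p & forall w, simplex m w -> bnd p (Pw A B Q Rc w).
Proof.
have [K0 /spectral_radius_decay[c [r dK]]] := stab.
pose X i := lyap (A + B *m K0) (stage_cost (Q i) (Rc i) K0).
exists (\sum_i opnorm (X i)); first by rewrite sumr_ge0// => i _; exact: opnorm_ge0.
move=> w sw; apply: bnd_quad; first by case: (possemidef_Pw sw).
move=> v; rewrite ger0_norm; last by case: (possemidef_Pw sw).
have [D XE D0] := Pw_le_lyap sw dK.
apply: (@le_trans _ _ (quad (Pw A B Q Rc w + D) v)).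
  by rewrite [leRHS]quadE bilMD lerDl -quadE.
rewrite -XE lyap_scalarized quadE bilM_sum mulr_suml; apply: ler_sum => i _.
rewrite bilMZ; apply: le_trans (ler_norm _) _.
have w0 : 0 <= w 0 i by case: sw.
rewrite normrM ger0_norm// -[leRHS]mul1r ler_pM//; first exact: simplex_le1.
by rewrite expr2; exact: bnd_opnorm.
Qed.

Lemma opnorm_Pw_le w : simplex m w -> opnorm (Pw A B Q Rc w) <= Pmax A B Q Rc.
Proof.
move=> sw; apply: ub_le_sup; last by exists w.
have [p p0 bp] := Pw_bounded.
by exists p => _ [w' /bp bw' <-]; exact: opnorm_le.
Qed.

Lemma opnorm_Kw_le w : simplex m w -> opnorm (Kw A B Q Rc w) <= Kmax A B Q Rc.
Proof.
move=> sw; apply: ub_le_sup; last by exists w.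
have [p p0 bp] := Pw_bounded.
exists (iota * opnorm B * p * opnorm A) => _ [w' sw' <-].
apply: opnorm_le; first by rewrite !mulr_ge0// opnorm_ge0.
apply: (gain_bnd (possemidef_Rw sw') iota0 (coercive_Rw sw')) => //.
- exact: opnorm_ge0.
- exact: opnorm_ge0.
- exact: bnd_opnorm.
- exact: bnd_opnorm.
- exact: possemidef_Pw.
- exact: bp.
Qed.

Section Perturbation.
Variables (G tau gam T : R).
Hypotheses (G1 : 1 <= G) (iotaG : iota <= G) (T1 : 1 <= T).
Hypothesis TE : tau ^+ 2 / (1 - gam ^+ 2) = T.
Hypotheses (bA : bnd G A) (bB : bnd G B).
Hypotheses (bQ : forall i, bnd G (Q i)) (bR : forall i, bnd G (Rc i)).
Hypothesis bK : forall w, simplex m w -> bnd G (Kw A B Q Rc w).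
Hypothesis dK : forall w, simplex m w -> decay tau gam (A + B *m Kw A B Q Rc w).

Local Notation K := (Kw A B Q Rc).
Local Notation P := (Pw A B Q Rc).
Local Notation L w := (A + B *m Kw A B Q Rc w).
Local Notation X w i := (lyap (L w) (stage_cost (Q i) (Rc i) (K w))).

Let G0 : 0 <= G. Proof. exact: le_trans ler01 G1. Qed.
Let T0 : 0 <= T. Proof. exact: le_trans ler01 T1. Qed.

(** Rounds lower-order terms up to the leading monomial, after which [lra] only adds
    coefficients. *)
Lemma monomial_le eps a b c e : 0 <= eps -> (a <= b)%N -> (c <= e)%N ->
  G ^+ a * T ^+ c * eps <= G ^+ b * T ^+ e * eps.
Proof.
move=> e0 ab ce; rewrite ler_wpM2r// ler_pM ?exprn_ge0//; exact: ler_weXn2l.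
Qed.

Lemma stage_cost_bnd w i : simplex m w ->
  bnd (2 * G ^+ 3) (stage_cost (Q i) (Rc i) (K w)).
Proof.
move=> sw; apply: (@bnd_le _ _ _ (G + G * G * G)).
  have : G ^+ 1 <= G ^+ 3 by exact: ler_weXn2l.
  by rewrite expr1; lra.
apply: bndD => //; apply: bndM; rewrite ?mulr_ge0//; last exact: bK.
by apply: bndM => //; apply: bndT; exact: bK.
Qed.

Lemma value_bnd w i : simplex m w -> bnd (2 * G ^+ 3 * T) (X w i).
Proof.
move=> sw; rewrite -TE mulrA; apply: (lyapunov_bnd (dK sw) (lyapE _ (dK sw))).
  by rewrite mulr_ge0// exprn_ge0.
exact: stage_cost_bnd.
Qed.

Section TwoWeights.
Variables (w w' : 'rV[R]_m) (eps : R).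
Hypotheses (sw : simplex m w) (sw' : simplex m w') (eps0 : 0 <= eps).
Hypothesis near_w : norm1 (w - w') <= eps.

Lemma combination_bnd p q (c : R) (F : 'I_m -> 'M[R]_(p, q)) : 0 <= c ->
  (forall i, bnd c (F i)) -> bnd (c * eps) (\sum_i (w - w') 0 i *: F i).
Proof.
move=> c0 bF; apply: (@bnd_le _ _ _ (\sum_i `|(w - w') 0 i| * c)).
  by rewrite -mulr_suml mulrC ler_wpM2l.
by apply: bnd_sum => i; exact: bndZ.
Qed.

(* K_{w'} is only suboptimal for the costs of w, hence P_w <= sum_i w_i X_i(w'), while
   P_{w'} = sum_i w'_i X_i(w'). *)
Lemma Pw_sub_le v : quad (P w - P w') v <= 2 * G ^+ 3 * T * eps * norm2 v ^+ 2.
Proof.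
have [D XE D0] := Pw_le_lyap sw (dK sw').
have -> : P w - P w' = \sum_i (w - w') 0 i *: X w' i - D.
  have -> : \sum_i (w - w') 0 i *: X w' i = P w + D - P w'.
    rewrite -XE -(lyap_Kw sw' (dK sw')) !lyap_scalarized -sumrB.
    by apply: eq_bigr => i _; rewrite -scalerBl !mxE.
  by rewrite addrAC addrK.
rewrite quadE bilMB; apply: (@le_trans _ _ (bil (\sum_i (w - w') 0 i *: X w' i) v v)).
  by rewrite gerBl -quadE.
apply: le_trans (ler_norm _) _; rewrite expr2; apply: combination_bnd => [|i].
  by rewrite mulr_ge0// mulr_ge0// exprn_ge0.
exact: value_bnd.
Qed.

End TwoWeights.

Section LipschitzInWeight.
Variables (w w' : 'rV[R]_m) (eps : R).
Hypotheses (sw : simplex m w) (sw' : simplex m w') (eps0 : 0 <= eps).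
Hypothesis near_w : norm1 (w - w') <= eps.

(** [Pw_sub_le] is applied to the two weights in both orders; P_w - P_w' being symmetric, [bnd_quad]
    keeps the constant. *)
Lemma Pw_lipschitz : bnd (2 * G ^+ 3 * T * eps) (P w - P w').
Proof.
apply: bnd_quad.
  by rewrite linearB/= (possemidef_Pw sw).1 (possemidef_Pw sw').1.
move=> v; rewrite ler_norml lerNl; apply/andP; split; last exact: Pw_sub_le.
have -> : - quad (P w - P w') v = quad (P w' - P w) v.
  by rewrite !quadE !bilMB opprB.
apply: Pw_sub_le => //; apply: le_trans near_w; rewrite /norm1.
by apply: ler_sum => i _; rewrite -normrN !mxE opprB.
Qed.

Lemma Kw_lipschitz : bnd (5 * G ^+ 7 * T * eps) (K w - K w').
Proof.
have p0 : 0 <= 2 * G ^+ 3 * T * eps by rewrite mulr_ge0// mulr_ge0// mulr_ge0// exprn_ge0.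
have bDR : bnd (G * eps) (Rw Rc w - Rw Rc w').
  have -> : Rw Rc w - Rw Rc w' = \sum_i (w - w') 0 i *: Rc i.
    by rewrite -sumrB; apply: eq_bigr => i _; rewrite -scalerBl !mxE.
  exact: combination_bnd.
have c0 : 0 <= G * eps by rewrite mulr_ge0.
apply: (@bnd_le _ _ _ (iota * (G * (2 * G ^+ 3 * T * eps) * G +
    (G * eps + G * (2 * G ^+ 3 * T * eps) * G) * G))).
  apply: (@le_trans _ _ (G * (G * (2 * G ^+ 3 * T * eps) * G +
    (G * eps + G * (2 * G ^+ 3 * T * eps) * G) * G))).
    by rewrite ler_wpM2r// addr_ge0// !mulr_ge0// addr_ge0// !mulr_ge0.
  (* The terms are 2 G^6 T + G^3 + 2 G^7 T, hence 5 = 2 + 1 + 2. *)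
  have := monomial_le eps0 (isT : 6 <= 7)%N (isT : 1 <= 1)%N.
  have := monomial_le eps0 (isT : 3 <= 7)%N (isT : 0 <= 1)%N.
  by rewrite expr0 mulr1 expr1; lra.
exact: (gain_lipschitz iota0 (possemidef_Rw sw) (possemidef_Rw sw') (coercive_Rw sw)
  (coercive_Rw sw') (possemidef_Pw sw) (possemidef_Pw sw') G0 G0 G0 p0 c0 bA bB
  (bK sw') Pw_lipschitz bDR).
Qed.

Lemma closed_loop_bnd v : simplex m v -> bnd (2 * G ^+ 2) (L v).
Proof.
move=> sv; apply: (@bnd_le _ _ _ (G + G * G)).
  have : G ^+ 1 <= G ^+ 2 by exact: ler_weXn2l.
  by rewrite expr1 expr2; lra.
by apply: bndD => //; apply: bndM => //; exact: bK.
Qed.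

Lemma value_lipschitz i : bnd (50 * G ^+ 13 * T ^+ 3 * eps) (X w i - X w' i).
Proof.
have bDK := Kw_lipschitz.
have k0 : 0 <= 5 * G ^+ 7 * T * eps by rewrite mulr_ge0// mulr_ge0// mulr_ge0// exprn_ge0.
have bDL : bnd (G * (5 * G ^+ 7 * T * eps)) (L w - L w').
  by rewrite opprD addrACA subrr add0r -mulmxBr; exact: bndM.
have bDM := stage_cost_lipschitz (Q i) G0 G0 k0 (bR i) (bK sw) (bK sw') bDK.
have l0 : 0 <= 2 * G ^+ 2 by rewrite mulr_ge0// exprn_ge0.
have x0 : 0 <= 2 * G ^+ 3 * T by rewrite mulr_ge0// mulr_ge0// exprn_ge0.
have dl0 : 0 <= G * (5 * G ^+ 7 * T * eps) by rewrite mulr_ge0.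
have := lyapunov_lipschitz (dK sw) (lyapE _ (dK sw)) (lyapE _ (dK sw')) l0 x0 dl0 _
  (closed_loop_bnd sw) (closed_loop_bnd sw') (value_bnd i sw') bDL bDM.
rewrite TE => H; apply: bnd_le (H _); last by rewrite addr_ge0 ?mulr_ge0.
(* The two closed-loop terms give 20 G^13 T^3 each, and the stage cost gives 10 G^9 T^2. *)
have := monomial_le eps0 (isT : 9 <= 13)%N (isT : 2 <= 3)%N; lra.
Qed.

Lemma value_trace_lipschitz i :
  `|\tr (X w i) - \tr (X w' i)| <= n%:R * (50 * G ^+ 13 * T ^+ 3 * eps).
Proof. by rewrite -raddfB; apply: mxtrace_bnd; exact: value_lipschitz. Qed.

End LipschitzInWeight.
End Perturbation.

Section DecayConstants.
Variables (L : 'M[R]_n) (tau gam : R).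
Hypotheses (n0 : (0 < n)%N) (dL : decay tau gam L).

(** At k = 0 the decay bound concerns the identity, which has a diagonal entry 1 since n > 0. *)
Lemma decay_ge1 : 1 <= tau.
Proof.
have [_ _ /(_ 0%N)] := dL; rewrite !expr0 mulr1 => b1.
by have := entry_le_bnd (Ordinal n0) (Ordinal n0) b1; rewrite mxE eqxx normr1.
Qed.

Lemma decay_ratio_ge1 : 1 <= tau ^+ 2 / (1 - gam ^+ 2).
Proof.
have t1 := decay_ge1; have [_ /andP[g0 g1] _] := dL.
have g2 : gam ^+ 2 < 1 by rewrite expr_lt1.
rewrite ler_pdivlMr ?subr_gt0// mul1r (@le_trans _ _ 1) ?exprn_ege1//.
by rewrite gerBl exprn_ge0.
Qed.

End DecayConstants.
End Scalarized.

(** * Moments of the noise and the average cost *)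

Section NormalMoments.
Context {R : realType}.
Local Notation mu := (@lebesgue_measure R).
Variable s : R.
Hypothesis s0 : 0 < s.

Let s_neq0 : s != 0. Proof. by rewrite gt_eqF. Qed.

(** Change of variables with the Radon-Nikodym derivative, which agrees almost everywhere with the
    density. *)
Lemma ge0_integral_normal_prob (f : measurableTypeR R -> \bar R) : measurable_fun setT f ->
  (forall x, 0 <= f x)%E ->
  (\int[normal_prob 0 s]_x f x = \int[mu]_x (f x * (normal_pdf 0 s x)%:E))%E.
Proof.
move=> mf f0; have dom := @normal_prob_dominates R 0 s.
rewrite -(Radon_Nikodym_SigmaFinite.change_of_variables dom f0 measurableT mf).
apply: ae_eq_integral => //.
- apply: emeasurable_funM => //.
  exact: measurable_int (Radon_Nikodym_SigmaFinite.f_integrable dom).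
- by apply: emeasurable_funM => //; apply/measurable_EFinP; exact: measurable_normal_pdf.
- apply: ae_eqe_mul2l; apply: integral_ae_eq => //.
  + exact: Radon_Nikodym_SigmaFinite.f_integrable.
  + by apply/measurable_EFinP; exact: measurable_normal_pdf.
  + by move=> E _ mE; rewrite -Radon_Nikodym_SigmaFinite.f_integral.
Qed.

Lemma normal_pdf0E (t x : R) : t != 0 ->
  normal_pdf 0 t x = normal_peak t * expR (- x ^+ 2 / (t ^+ 2 *+ 2)).
Proof. by move=> t0; rewrite normal_pdfE// /normal_fun subr0. Qed.

(** Doubling the deviation absorbs the factor x^2. The right side is a multiple of a probability
    density, so the second moment is at most 16 s^2 with no exact integration; this is the 16 of the
    final constant. *)
Lemma sqr_normal_pdf_le (x : R) :
  x ^+ 2 * normal_pdf 0 s x <= 16 * s ^+ 2 * normal_pdf 0 (2 * s) x.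
Proof.
have s2_neq0 : 2 * s != 0 by rewrite mulf_neq0.
rewrite !normal_pdf0E//.
have -> : normal_peak s = 2 * normal_peak (2 * s).
  rewrite /normal_peak.
  have -> : (2 * s) ^+ 2 * pi *+ 2 = 2 ^+ 2 * (s ^+ 2 * pi *+ 2) by ring.
  rewrite sqrtrM ?sqr_ge0// sqrtr_sqr ger0_norm// invfM mulrA divff ?mul1r//.
(* In terms of y the claim is y e^(-4y) <= e^(-y). *)
set y := x ^+ 2 / (8 * s ^+ 2).
have y0 : 0 <= y by rewrite divr_ge0 ?sqr_ge0// mulr_ge0// sqr_ge0.
have -> : - x ^+ 2 / (s ^+ 2 *+ 2) = - (y *+ 4) by rewrite /y; field.
have -> : - x ^+ 2 / ((2 * s) ^+ 2 *+ 2) = - y by rewrite /y; field.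
have -> : x ^+ 2 = 8 * s ^+ 2 * y by rewrite /y; field.
have H : y * expR (- (y *+ 4)) <= expR (- y).
  have -> : - (y *+ 4) = - y + - (y *+ 3) by ring.
  rewrite expRD mulrCA ler_piMr ?expR_ge0// expRN ler_pdivrMr ?expR_gt0// mul1r.
  have := expR_ge1Dx (y *+ 3); lra.
have p0 := normal_peak_ge0 (2 * s).
rewrite [leRHS](_ : _ = 8 * s ^+ 2 * (2 * normal_peak (2 * s)) * expR (- y)); last by ring.
rewrite [leLHS](_ : _ = 8 * s ^+ 2 * (2 * normal_peak (2 * s)) *
  (y * expR (- (y *+ 4)))); last by ring.
have s_ge0 := ltW s0.
by rewrite ler_wpM2l// !mulr_ge0.
Qed.

Lemma normal_second_moment_le :
  (\int[normal_prob 0 s]_x (x ^+ 2)%:E <= (16 * s ^+ 2)%:E)%E.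
Proof.
rewrite ge0_integral_normal_prob; last 2 first.
- by apply/measurable_EFinP; exact: measurable_funX.
- by move=> x; rewrite lee_fin sqr_ge0.
apply: (@le_trans _ _ (\int[mu]_x ((16 * s ^+ 2)%:E * (normal_pdf 0 (2 * s) x)%:E))%E).
  apply: ge0_le_integral => //.
  - by move=> x _; rewrite -EFinM lee_fin mulr_ge0 ?sqr_ge0// normal_pdf_ge0.
  - apply: emeasurable_funM; apply/measurable_EFinP; first exact: measurable_funX.
    exact: measurable_normal_pdf.
  - apply: emeasurable_funM => //; apply/measurable_EFinP; exact: measurable_normal_pdf.
  - by move=> x _; rewrite -!EFinM lee_fin sqr_normal_pdf_le.
rewrite ge0_integralZl//; last 3 first.
- by apply/measurable_EFinP; exact: measurable_normal_pdf.
- by move=> x _; rewrite lee_fin normal_pdf_ge0.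
- by rewrite lee_fin mulr_ge0// sqr_ge0.
by rewrite integral_normal_pdf mule1.
Qed.

Lemma normal_prob_opp (U : set R) : measurable U ->
  normal_prob 0 s [set x | U (- x)] = normal_prob 0 s U.
Proof.
move=> mU; rewrite /normal_prob.
have even x : normal_pdf 0 s (- x) = normal_pdf 0 s x.
  by rewrite !normal_pdf0E// sqrrN.
rewrite (_ : [set x | U (- x)] = (-%R : _ -> measurableTypeR R) @^-1` U)//.
transitivity (\int[mu]_(x in (-%R : _ -> measurableTypeR R) @^-1` U)
    ((fun y => (normal_pdf 0 s y)%:E) \o (-%R : _ -> measurableTypeR R)) x)%E.
  by apply: eq_integral => x _ /=; rewrite even.
rewrite -ge0_integral_pushforward//=.
- by apply: eq_measure_integral => A mA AU; exact: lebesgue_measureN.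
- by apply/measurable_EFinP/measurable_funTS; exact: measurable_normal_pdf.
- by move=> y _; rewrite lee_fin normal_pdf_ge0.
Qed.

End NormalMoments.

Section SquareIntegrable.
Context {R : realType} {disp : measure_display} {Omega : measurableType disp}.
Variable P : probability Omega R.

Lemma lee12 : (1 <= 2%:E :> \bar R)%E.
Proof. by rewrite lee_fin ler1n. Qed.

Lemma Lfun_lincomb (p : R) (I : Type) (r : seq I) (c : I -> R) (f : I -> Omega -> R) :
  1 <= p -> (forall i, f i \in Lfun P p%:E) ->
  (fun w => \sum_(i <- r) c i * f i w) \in Lfun P p%:E.
Proof.
move=> p1 fp; elim: r => [|i r IH].
  by under eq_fun do rewrite big_nil; exact: Lfun_cst.
under eq_fun do rewrite big_cons.
have p1e : (1 <= p%:E)%E by rewrite lee_fin.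
have [_ ] := Lfun_addr_closed P p1e; apply => //.
rewrite (_ : (fun _ => _) = c i \o* f i); first exact: Lfun_scale.
by apply/funext => w /=; rewrite mulrC.
Qed.

Lemma fine_expectation_lincomb (I : Type) (r : seq I) (c : I -> R) (f : I -> Omega -> R) :
  (forall i, f i \in Lfun P 1) ->
  fine 'E_P[fun w => \sum_(i <- r) c i * f i w] = \sum_(i <- r) c i * fine 'E_P[f i].
Proof.
move=> f1; elim: r => [|i r IH].
  by rewrite big_nil; under eq_fun do rewrite big_nil; rewrite expectation_cst.
rewrite big_cons -IH; under eq_fun do rewrite big_cons.
have rL1 : (fun w => \sum_(i <- r) c i * f i w) \in Lfun P 1 by exact: Lfun_lincomb.
have iL1 : (c i \o* f i) \in Lfun P 1 by exact: Lfun_scale.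
rewrite (_ : (fun _ => _) = (c i \o* f i) \+ (fun w => \sum_(i <- r) c i * f i w)).
  rewrite expectationD// fineD; try exact: expectation_fin_num.
  rewrite expectationZl// fineM//; last exact: expectation_fin_num.
by apply/funext => w /=; rewrite mulrC.
Qed.

Lemma Lfun2_of_sqr (X : Omega -> R) : measurable_fun setT X ->
  (\int[P]_w (X w ^+ 2)%:E < +oo)%E -> X \in Lfun P 2%:E.
Proof.
move=> mX X2; rewrite inE; apply/andP; split; rewrite inE//=.
rewrite /finite_norm unlock poweR_lty//.
by under eq_integral => w _ do rewrite /= powR_mulrn// real_normK ?num_real//.
Qed.

(* (X, Y) and (-X, Y) have the same law, the product of m1 and m2. *)
Lemma indep_symmetric_expectation (X Y : Omega -> R) (m1 m2 : probability (measurableTypeR R) R) :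
  measurable_fun setT X -> measurable_fun setT Y -> X \* Y \in Lfun P 1 ->
  (forall U V : set R, measurable U -> measurable V ->
     P (X @^-1` U `&` Y @^-1` V) = m1 U * m2 V)%E ->
  (forall U : set R, measurable U -> m1 [set x | U (- x)] = m1 U) ->
  fine 'E_P[X \* Y] = 0.
Proof.
move=> mX mY XY1 indep sym.
pose phi w : (measurableTypeR R * measurableTypeR R)%type := (X w, Y w).
pose psi w : (measurableTypeR R * measurableTypeR R)%type := (- X w, Y w).
have mphi : measurable_fun setT phi by exact: measurable_fun_pair.
have mpsi : measurable_fun setT psi.
  by apply: measurable_fun_pair => //; exact: measurableT_comp.
have iXY : P.-integrable setT (EFin \o (X \* Y)) by exact/Lfun1_integrable.
pose g (z : measurableTypeR R * measurableTypeR R) := (z.1 * z.2)%:E.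
have mg : measurable_fun setT g.
  by apply/measurable_EFinP; apply: measurable_funM.
pose Phi : {mfun Omega >-> (measurableTypeR R * measurableTypeR R)%type} :=
  HB.pack phi (isMeasurableFun.Build _ _ _ _ phi mphi).
pose Psi : {mfun Omega >-> (measurableTypeR R * measurableTypeR R)%type} :=
  HB.pack psi (isMeasurableFun.Build _ _ _ _ psi mpsi).
have E1 : (\int[distribution P Phi]_z g z = 'E_P[X \* Y])%E.
  by rewrite unlock integral_distribution.
have gpsi : g \o Psi = (fun w => - ((X \* Y) w)%:E)%E.
  by apply/funext => w; rewrite /g /psi /= mulNr.
have E2 : (\int[distribution P Psi]_z g z = - 'E_P[X \* Y])%E.
  rewrite integral_distribution//; last by rewrite gpsi; exact: integrableN.
  have := expectationZl (-1) XY1; rewrite mulN1e => <-; rewrite gpsi unlock.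
  by apply: eq_integral => w _ /=; rewrite mulrN1 EFinN.
have EN : ('E_P[X \* Y] = - 'E_P[X \* Y])%E.
  have lawPhi C : measurable C -> (m1 \x m2)%E C = distribution P Phi C.
    by apply: product_measure_unique => U V mU mV; rewrite -indep.
  have lawPsi C : measurable C -> (m1 \x m2)%E C = distribution P Psi C.
    apply: product_measure_unique => U V mU mV /=.
    transitivity (m1 [set x | U (- x)%R] * m2 V)%E; last by rewrite sym.
    rewrite -indep//.
    rewrite -(setTI [set x | U (- x)]).
    exact: (@oppr_measurable R setT measurableT U mU).
  rewrite -E2 -{1}E1; apply: eq_measure_integral => C mC _.
  exact: etrans (esym (lawPhi C mC)) (lawPsi C mC).
have := expectation_fin_num XY1; move: EN; case: ('E_P[_])%E => // r [] /= rr _.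
lra.
Qed.

End SquareIntegrable.

(** * State covariances and the closed form of the average cost *)

Section StateMoments.
Context {R : realType} {n d : nat} {disp : measure_display} {Omega : measurableType disp}.
Variables (P : probability Omega R) (A : 'M[R]_n) (B : 'M[R]_(n, d)) (K : 'M[R]_(d, n)).
Variables (x0 : {RV P >-> n.-tuple R}) (xi : nat -> {RV P >-> n.-tuple R}).
Variable s2 : R.

Let z t i w := tnth (noise_family x0 xi t w) i.
Let x t i w := state A B x0 xi K t w i 0.
Let L := A + B *m K.
Let E (f : Omega -> R) := fine 'E_P[f].

(** The cost formula sees the noise only through these second-order facts. [zvar] starts at index 1,
    so the covariance of the initial state is left free. *)
Hypothesis zL2 : forall t i, z t i \in Lfun P 2%:E.
Hypothesis zvar : forall t i j, E (z t.+1 i \* z t.+1 j) = s2 *+ (i == j).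
Hypothesis zcov : forall t t' i j, (t < t')%N -> E (z t i \* z t' j) = 0.

Lemma state_step t i w : x t.+1 i w = \sum_k L i k * x t k w + z t.+1 i w.
Proof. by rewrite /x /z /= mulmxA -mulmxDl !mxE. Qed.

Lemma state_step_fun t i :
  x t.+1 i = (fun w => \sum_k L i k * x t k w) \+ z t.+1 i.
Proof. by apply/funext => w; rewrite state_step. Qed.

Lemma state_Lfun2 t i : x t i \in Lfun P 2%:E.
Proof.
elim: t i => [|t IH] i.
  by rewrite (_ : x 0 i = z 0 i)//; apply/funext => w; rewrite /x /z /= mxE.
rewrite state_step_fun; have [_] := Lfun_addr_closed P (@lee12 R); apply => //.
by apply: Lfun_lincomb; rewrite ?ler1n.
Qed.

Lemma expectation_lincomb_mul (c : 'I_n -> R) (f : 'I_n -> Omega -> R) g :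
  (forall k, f k \in Lfun P 2%:E) -> g \in Lfun P 2%:E ->
  E ((fun w => \sum_k c k * f k w) \* g) = \sum_k c k * E (f k \* g).
Proof.
move=> f2 g2; rewrite -(@fine_expectation_lincomb _ _ _ P _ _ c (fun k => f k \* g)); last first.
  by move=> k; exact: Lfun2_mul_Lfun1.
congr (fine _); congr expectation; apply/funext => w /=; rewrite mulr_suml.
by apply: eq_bigr => k _; rewrite mulrA.
Qed.

Lemma expectation_mulDl f g h : f \in Lfun P 2%:E -> g \in Lfun P 2%:E -> h \in Lfun P 2%:E ->
  E ((f \+ g) \* h) = E (f \* h) + E (g \* h).
Proof.
move=> f2 g2 h2; have fh := Lfun2_mul_Lfun1 f2 h2; have gh := Lfun2_mul_Lfun1 g2 h2.
rewrite /E (_ : (f \+ g) \* h = (f \* h) \+ (g \* h)).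
  by rewrite expectationD// fineD// expectation_fin_num.
by apply/funext => w /=; rewrite mulrDl.
Qed.

Lemma expectation_mulC f g : E (f \* g) = E (g \* f).
Proof. by congr (fine _); congr expectation; apply/funext => w /=; rewrite mulrC. Qed.

Lemma state_noise_cov t t' i j : (t < t')%N -> E (x t i \* z t' j) = 0.
Proof.
elim: t i => [|t IH] i tt'.
  by rewrite (_ : x 0 i = z 0 i) ?zcov//; apply/funext => w; rewrite /x /z /= mxE.
have sL2 : (fun w => \sum_k L i k * x t k w) \in Lfun P 2%:E.
  by apply: Lfun_lincomb => [|k]; rewrite ?ler1n ?state_Lfun2.
rewrite state_step_fun expectation_mulDl// zcov// addr0 expectation_lincomb_mul//; last first.
  by move=> k; exact: state_Lfun2.
by rewrite big1// => k _; rewrite IH ?mulr0// ltnW.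
Qed.

(** Uncentred second moments, which is what a quadratic cost measures. *)
Definition state_cov t : 'M[R]_n := \matrix_(i, j) E (x t i \* x t j).

Lemma state_covS t : state_cov t.+1 = L *m state_cov t *m L^T + s2%:M.
Proof.
apply/matrixP => i j; rewrite !mxE.
have sL2 k : (fun w => \sum_l L k l * x t l w) \in Lfun P 2%:E.
  by apply: Lfun_lincomb => [|l]; rewrite ?ler1n ?state_Lfun2.
have xL2 := state_Lfun2.
rewrite {1}state_step_fun expectation_mulDl//; congr (_ + _).
  rewrite expectation_lincomb_mul//.
  transitivity (\sum_k L i k * \sum_l L j l * E (x t k \* x t l)).
    apply: eq_bigr => k _; congr (_ * _).
    rewrite expectation_mulC state_step_fun expectation_mulDl// [E (z _ _ \* _)]expectation_mulC.
    rewrite state_noise_cov// addr0 expectation_lincomb_mul//.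
    by apply: eq_bigr => l _; rewrite expectation_mulC.
  under eq_bigr do rewrite mulr_sumr; rewrite exchange_big/=.
  apply: eq_bigr => l _; rewrite [X in _ = X * _]mxE [X in _ = _ * X]mxE mulr_suml.
  apply: eq_bigr => k _.
  by rewrite [state_cov t k l]mxE; ring.
rewrite expectation_mulC state_step_fun expectation_mulDl// zvar.
rewrite expectation_lincomb_mul// big1 ?add0r; last first.
  by move=> k _; rewrite state_noise_cov// mulr0.
by rewrite eq_sym.
Qed.

Lemma quad_stage_cost (Q : 'M[R]_n) (Rc : 'M[R]_d) v :
  quad Q v + quad Rc (K *m v) = quad (stage_cost Q Rc K) v.
Proof. by rewrite /stage_cost [RHS]quadE bilMD -!quadE quad_congr. Qed.

Lemma quad_state_Lfun1 (M : 'M[R]_n) t :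
  (fun w => quad M (state A B x0 xi K t w)) \in Lfun P 1 /\
  E (fun w => quad M (state A B x0 xi K t w)) = \tr (M *m state_cov t).
Proof.
pose h j := fun w => \sum_i M i j * (x t i \* x t j) w.
have -> : (fun w => quad M (state A B x0 xi K t w)) = (fun w => \sum_j 1 * h j w).
  apply/funext => w; rewrite quadE bil_sumE; apply: eq_bigr => j _; rewrite mul1r.
  by apply: eq_bigr => i _ /=; rewrite mulrCA mulrA.
have xxL1 (i j : 'I_n) : x t i \* x t j \in Lfun P 1.
  by apply: Lfun2_mul_Lfun1; exact: state_Lfun2.
have hL1 j : h j \in Lfun P 1 by exact: Lfun_lincomb.
split; first exact: Lfun_lincomb.
rewrite /E fine_expectation_lincomb// mxtrace_mulC; apply: eq_bigr => j _.
by rewrite mul1r fine_expectation_lincomb// mxE; apply: eq_bigr => i _;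
  rewrite mxE mulrC expectation_mulC.
Qed.

Lemma expectation_average_cost (Q : 'M[R]_n) (Rc : 'M[R]_d) T :
  E (average_cost A B x0 xi Q Rc K T) =
  T%:R^-1 * \sum_(0 <= t < T.+1) \tr (stage_cost Q Rc K *m state_cov t).
Proof.
have [L1 EL] := all_and2 (quad_state_Lfun1 (stage_cost Q Rc K)).
rewrite /E (_ : average_cost _ _ _ _ _ _ _ _ = fun w => \sum_(0 <= t < T.+1)
    T%:R^-1 * quad (stage_cost Q Rc K) (state A B x0 xi K t w)).
  rewrite (@fine_expectation_lincomb _ _ _ P _ _ (fun=> T%:R^-1)
    (fun t w => quad (stage_cost Q Rc K) (state A B x0 xi K t w)))//.
  by rewrite -mulr_sumr; congr (_ * _); apply: eq_bigr => t _; exact: EL.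
apply/funext => w; rewrite /average_cost mulr_sumr; apply: eq_bigr => t _.
by rewrite quad_stage_cost.
Qed.

(** Cyclicity of the trace moves L from X to the covariance: tr (L^T X L S_t) = tr (X (S_(t+1) - s2
    I)), where S_t is [state_cov t]. *)
Lemma telescoping_average (Q : 'M[R]_n) (Rc : 'M[R]_d) (X : 'M[R]_n) T :
  X = L^T *m X *m L + stage_cost Q Rc K ->
  \sum_(0 <= t < T) \tr (stage_cost Q Rc K *m state_cov t) =
  \tr (X *m state_cov 0) - \tr (X *m state_cov T) + T%:R * (s2 * \tr X).
Proof.
move=> XE; elim: T => [|T IH]; first by rewrite big_nil subrr mul0r addr0.
rewrite big_nat_recr//= {}IH.
have -> : stage_cost Q Rc K = X - L^T *m X *m L by rewrite {1}XE addrC addKr.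
have trE : \tr (L^T *m X *m L *m state_cov T) = \tr (X *m (L *m state_cov T *m L^T)).
  by rewrite -!mulmxA [LHS]mxtrace_mulC !mulmxA.
rewrite mulmxBl raddfB/= trE state_covS mulmxDr mxtraceD mul_mx_scalar mxtraceZ -natr1.
ring.
Qed.

(** Y is the stationary covariance, the Lyapunov solution for L^T. The deviation from Y at time t is
    the initial one conjugated by L^t, hence bounded. *)
Lemma state_cov_bounded (X : 'M[R]_n) C r : decay C r L ->
  exists2 b, 0 <= b & forall t, `|\tr (X *m state_cov t)| <= b.
Proof.
move=> dL.
have dLT : decay C r L^T.
  have [C0 r01 bL] := dL; split=> // k.
  suff -> : L^T ^+ k = (L ^+ k)^T by exact: bndT.
  elim: k => [|k IH]; first by rewrite !expr0 trmx1.
  by rewrite exprS exprSr IH -!mulmxE trmx_mul.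
have [C0 /andP[r0 r1] bL] := dL.
pose Y := lyap L^T s2%:M.
have YE : Y = L *m Y *m L^T + s2%:M by have := lyapE s2%:M dLT; rewrite trmxK.
have DE t : state_cov t - Y = L ^+ t *m (state_cov 0 - Y) *m (L ^+ t)^T.
  elim: t => [|t IH]; first by rewrite expr0 trmx1 mulmx1 mul1mx.
  rewrite state_covS {1}YE opprD addrACA subrr addr0 -mulmxBl -mulmxBr IH.
  by rewrite exprS -mulmxE trmx_mul !mulmxA.
have [a a0 bX] := bnd_exists X; have [e e0 bD] := bnd_exists (state_cov 0 - Y).
exists (n%:R * (a * (C * e * C)) + `|\tr (X *m Y)|).
  by rewrite addr_ge0// !mulr_ge0.
move=> t; rewrite -(subrK Y (state_cov t)) mulmxDr linearD/=.
apply: le_trans (ler_normD _ _) _; rewrite lerD2r; apply: mxtrace_bnd.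
have bC : bnd C (L ^+ t).
  apply: bnd_le (bL t); rewrite ler_piMr//; exact: exprn_ile1 r0 (ltW r1).
apply: bndM; rewrite ?mulr_ge0// DE.
apply: bndM; rewrite ?mulr_ge0//; last exact: bndT.
exact: bndM.
Qed.

Lemma lqr_costE (Q : 'M[R]_n) (Rc : 'M[R]_d) C r : decay C r L ->
  lqr_cost A B x0 xi Q Rc K = s2 * \tr (lyap L (stage_cost Q Rc K)).
Proof.
move=> dL; set X := lyap L _; have XE := lyapE (stage_cost Q Rc K) dL.
have [b b0 bX] := state_cov_bounded X dL.
(* The shift avoids T = 0, where the factor T^-1 is 0 by convention. *)
apply: cvg_lim => //; rewrite -(cvg_shiftS _).
set l := s2 * \tr X.
apply/subr_cvg0.
apply: (@squeeze_cvgr _ _ _ _ (fun T => - ((b + b + `|l|) * harmonic T))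
   (fun T => (b + b + `|l|) * harmonic T)).
- near=> T; have := expectation_average_cost Q Rc T.+1; rewrite /E /= -ler_norml => ->.
  rewrite (telescoping_average _ XE) -/X -/l.
  have T0 : (T.+1%:R : R) != 0 by rewrite pnatr_eq0.
  (* The cost sums one more stage than it divides by; the surplus l joins the bounded error. *)
  have -> : T.+1%:R^-1 * (\tr (X *m state_cov 0) - \tr (X *m state_cov T.+2) + T.+2%:R * l) - l
      = (\tr (X *m state_cov 0) - \tr (X *m state_cov T.+2) + l) * T.+1%:R^-1.
    rewrite -[T.+2%:R]natr1 mulrDl mul1r addrCA mulrDr mulKf//.
    by rewrite addrAC subrr add0r mulrC.
  rewrite normrM (ger0_norm (_ : 0 <= _^-1)) ?invr_ge0// ler_wpM2r ?invr_ge0//.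
  apply: le_trans (ler_normD _ _) _; rewrite lerD2r.
  by apply: le_trans (ler_normB _ _) _; rewrite lerD.
- rewrite -oppr0; apply: cvgN; rewrite -(mulr0 (b + b + `|l|)).
  by apply: cvgMl_tmp; exact: cvg_harmonic.
- rewrite -(mulr0 (b + b + `|l|)).
  by apply: cvgMl_tmp; exact: cvg_harmonic.
Unshelve. all: by end_near. Qed.

End StateMoments.

Section NoiseMoments.
Context {R : realType} {n : nat} {disp : measure_display} {Omega : measurableType disp}.
Variable P : probability Omega R.

(** This is the variance s^2, kept unevaluated: costs are proportional to it, and a sign and an
    upper bound are enough. *)
Definition normal_second_moment (s : R) : R :=
  fine (\int[normal_prob 0 s]_x (x ^+ 2)%:E)%E.

Lemma normal_second_moment_bounds s : 0 < s -> 0 <= normal_second_moment s <= 16 * s ^+ 2.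
Proof.
move=> s0; have := normal_second_moment_le s0; rewrite /normal_second_moment.
have : (0 <= \int[normal_prob 0 s]_x (x ^+ 2)%:E)%E.
  by apply: integral_ge0 => x _; rewrite lee_fin sqr_ge0.
by case: (integral _ _ _) => //= r; rewrite !lee_fin => -> ->.
Qed.

Lemma normal_law_sqr (X : Omega -> R) s : 0 < s -> measurable_fun setT X ->
  (forall U : set R, measurable U -> P (X @^-1` U) = normal_prob 0 s U) ->
  X \in Lfun P 2%:E /\ fine 'E_P[X \* X] = normal_second_moment s.
Proof.
move=> s0 mX lawX.
have mY : measurable_fun setT (X : Omega -> measurableTypeR R) by exact: mX.
pose Y : {mfun Omega >-> measurableTypeR R} :=
  HB.pack (X : Omega -> measurableTypeR R) (isMeasurableFun.Build _ _ _ _ _ mY).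
have XE : (\int[P]_w (X w ^+ 2)%:E = \int[normal_prob 0 s]_x (x ^+ 2)%:E)%E.
  transitivity (\int[distribution P Y]_x (x ^+ 2)%:E)%E.
    rewrite ge0_integral_distribution//; last by move=> x; rewrite lee_fin sqr_ge0.
    by apply/measurable_EFinP; exact: measurable_funX.
  by apply: eq_measure_integral => U mU _; exact: lawX.
split.
  apply: Lfun2_of_sqr => //; rewrite XE.
  by apply: le_lt_trans (normal_second_moment_le s0) _; exact: ltry.
by rewrite /normal_second_moment -XE unlock; congr fine.
Qed.

Variables (sigma : R) (x0 : {RV P >-> n.-tuple R}) (xi : nat -> {RV P >-> n.-tuple R}).
Hypothesis sigma0 : 0 < sigma.
Hypothesis noise : lqr_noise sigma x0 xi.

Let sc t := if t is 0 then 1 else sigma.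
Let z t i w := tnth (noise_family x0 xi t w) i.

Lemma noise_scale_gt0 t : 0 < sc t.
Proof. by case: t. Qed.

Lemma isotropic_noise_family t : isotropic_normal (sc t) (noise_family x0 xi t).
Proof. by case: noise => N0 Nxi _; case: t. Qed.

Lemma measurable_noise_component t i : measurable_fun setT (z t i).
Proof.
apply: (@measurableT_comp _ _ _ _ _ _ (fun v : n.-tuple R => tnth v i)) => //.
exact: measurable_tnth.
Qed.

Lemma noise_component_law t i (U : set R) : measurable U ->
  P (z t i @^-1` U) = normal_prob 0 (sc t) U.
Proof.
move=> mU; pose V k := if k == i then U else setT.
have mV k : measurable (V k) by rewrite /V; case: ifP.
have := isotropic_noise_family t mV.
rewrite (bigD1 i)//= big1 ?mule1; last first.
  by move=> k /negbTE ki; rewrite /V ki probability_setT.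
rewrite {2}/V eqxx => <-; congr (P _); apply/seteqP; split=> w /=.
  by move=> Uw k; rewrite /V; case: eqP => // ->.
by move=> /(_ i); rewrite /V eqxx.
Qed.

Lemma noise_components_indep t i j (U U' : set R) : i != j ->
  measurable U -> measurable U' ->
  (P (z t i @^-1` U `&` z t j @^-1` U') =
   normal_prob 0 (sc t) U * normal_prob 0 (sc t) U')%E.
Proof.
move=> ij mU mU'; pose V k := if k == i then U else if k == j then U' else setT.
have mV k : measurable (V k) by rewrite /V; case: ifP => // _; case: ifP.
have := isotropic_noise_family t mV.
rewrite (bigD1 i)//= (bigD1 j) 1?eq_sym//= big1 ?mule1; last first.
  by move=> k /andP[/negbTE ki /negbTE kj]; rewrite /V ki kj probability_setT.
rewrite {2 3}/V !eqxx eq_sym (negbTE ij) => <-.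
congr (P _); apply/seteqP; split=> w /=.
  by move=> [Uw Uw'] k; rewrite /V; case: eqP => [->//|_]; case: eqP => // ->.
move=> H; split; first by have := H i; rewrite /V eqxx.
by have := H j; rewrite /V eqxx eq_sym (negbTE ij).
Qed.

Lemma noise_times_indep t t' i j (U U' : set R) : t != t' ->
  measurable U -> measurable U' ->
  (P (z t i @^-1` U `&` z t' j @^-1` U') =
   normal_prob 0 (sc t) U * normal_prob 0 (sc t') U')%E.
Proof.
move=> tt' mU mU'; have [_ _ indep] := noise.
pose V k : set (n.-tuple R) :=
  if k == t then [set v | U (tnth v i)] else [set v | U' (tnth v j)].
have mtnth (k : 'I_n) (W : set R) : measurable W -> measurable [set v : n.-tuple R | W (tnth v k)].
  move=> mW; rewrite -[X in measurable X]setTI.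
  exact: (@measurable_tnth _ _ _ k measurableT W mW).
have mV k : measurable (V k) by rewrite /V; case: ifP => _; exact: mtnth.
have t't : (t' == t) = false by rewrite eq_sym (negbTE tt').
have := indep [:: t; t'] V; rewrite /= inE tt' => /(_ isT mV).
rewrite !big_cons big_nil mule1 {2 3}/V eqxx t't.
rewrite -(noise_component_law t i mU) -(noise_component_law t' j mU') => <-.
congr (P _); apply/seteqP; split=> w /=.
  move=> [Uw Uw'] k /=; rewrite !inE => /orP[/eqP->|/eqP->].
    by rewrite /V eqxx.
  by rewrite /V t't.
move=> H; split.
  by have := H t; rewrite /V /= eqxx; apply; rewrite inE eqxx.
by have := H t'; rewrite /V /= t't; apply; rewrite !inE eqxx orbT.
Qed.

Lemma noise_component_Lfun2 t i : z t i \in Lfun P 2%:E.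
Proof.
by have [] := normal_law_sqr (noise_scale_gt0 t) (measurable_noise_component t i)
  (@noise_component_law t i).
Qed.

Lemma noise_component_cov t i j :
  fine 'E_P[z t i \* z t j] = normal_second_moment (sc t) *+ (i == j).
Proof.
have [<-|ij] := eqVneq i j.
  by have [] := normal_law_sqr (noise_scale_gt0 t) (measurable_noise_component t i)
    (@noise_component_law t i).
apply: (indep_symmetric_expectation (m1 := normal_prob 0 (sc t)) (m2 := normal_prob 0 (sc t))).
- exact: measurable_noise_component.
- exact: measurable_noise_component.
- by apply: Lfun2_mul_Lfun1; exact: noise_component_Lfun2.
- by move=> U V mU mV; exact: noise_components_indep.
- by move=> U mU; apply: normal_prob_opp => //; exact: noise_scale_gt0.
Qed.

Lemma noise_times_cov t t' i j : (t < t')%N -> fine 'E_P[z t i \* z t' j] = 0.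
Proof.
move=> tt'.
apply: (indep_symmetric_expectation (m1 := normal_prob 0 (sc t)) (m2 := normal_prob 0 (sc t'))).
- exact: measurable_noise_component.
- exact: measurable_noise_component.
- by apply: Lfun2_mul_Lfun1; exact: noise_component_Lfun2.
- by move=> U V mU mV; apply: noise_times_indep => //; rewrite ltn_eqF.
- by move=> U mU; apply: normal_prob_opp => //; exact: noise_scale_gt0.
Qed.

Lemma lqr_noise_costE d (A : 'M[R]_n) (B : 'M[R]_(n, d)) K (Q : 'M[R]_n) (Rc : 'M[R]_d) C r :
  decay C r (A + B *m K) ->
  lqr_cost A B x0 xi Q Rc K =
  normal_second_moment sigma * \tr (lyap (A + B *m K) (stage_cost Q Rc K)).
Proof.
apply: (lqr_costE noise_component_Lfun2).
- by move=> t; exact: (noise_component_cov t.+1).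
- exact: noise_times_cov.
Qed.

End NoiseMoments.

(** * Scalarization and Pareto optimality *)

Section Simplex.
Context {R : realType} {m : nat}.
Implicit Types w v : 'rV[R]_m.

Lemma simplex_delta i : simplex m (delta_mx 0 i : 'rV[R]_m).
Proof.
split=> [j|]; first by rewrite mxE eqxx /=; case: eqP.
rewrite /norm1 (bigD1 i)//= big1 ?addr0 => [|j /negbTE ji]; rewrite mxE !eqxx ?ji/=.
  by rewrite normr1.
by rewrite normr0.
Qed.

Lemma simplex_segment w v (t : R) : simplex m w -> simplex m v -> 0 <= t <= 1 ->
  simplex m (w + t *: (v - w)).
Proof.
move=> sw sv /andP[t0 t1].
have E i : (w + t *: (v - w)) 0 i = (1 - t) * w 0 i + t * v 0 i by rewrite !mxE; ring.
have pos i : 0 <= (w + t *: (v - w)) 0 i.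
  by rewrite E addr_ge0// mulr_ge0 ?subr_ge0//; [case: sw|case: sv].
split=> //; rewrite /norm1; under eq_bigr do rewrite ger0_norm// E.
by rewrite big_split/= -!mulr_sumr !simplex_sum// !mulr1 subrK.
Qed.

Lemma norm1_ge0 w : 0 <= norm1 w.
Proof. by rewrite /norm1 sumr_ge0. Qed.

Lemma norm1Z (a : R) w : norm1 (a *: w) = `|a| * norm1 w.
Proof. by rewrite /norm1 mulr_sumr; apply: eq_bigr => i _; rewrite mxE normrM. Qed.

Lemma entry_le_mxnorm w i : `|w 0 i| <= `|w|.
Proof.
have -> : `|w| = \big[Num.max/0]_ij `|w ij.1 ij.2| by exact: mx_normrE.
exact: (le_bigmax _ (fun ij => `|w ij.1 ij.2|) (0, i)).
Qed.

Lemma mxnorm_le w (a : R) : 0 <= a -> (forall i, `|w 0 i| <= a) -> `|w| <= a.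
Proof.
move=> a0 wa; have -> : `|w| = \big[Num.max/0]_ij `|w ij.1 ij.2| by exact: mx_normrE.
by apply: bigmax_le => // -[i j] _; rewrite ord1.
Qed.

Lemma norm1_le_mxnorm w : norm1 w <= m%:R * `|w|.
Proof.
rewrite /norm1 mulr_natl -[X in _ *+ X]card_ord -sumr_const; apply: ler_sum => i _.
exact: entry_le_mxnorm.
Qed.

Lemma norm1_simplex_sub w v : simplex m w -> simplex m v -> norm1 (w - v) <= 2.
Proof.
move=> [_ w1] [_ v1]; have -> : 2 = norm1 w + norm1 v by rewrite w1 v1.
rewrite /norm1 -big_split/=.
by apply: ler_sum => i _; rewrite !mxE; exact: ler_normB.
Qed.

Lemma sum_mul_le_norm1 w (f : 'I_m -> R) c : (forall i, `|f i| <= c) ->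
  `|\sum_i w 0 i * f i| <= norm1 w * c.
Proof.
move=> fc; apply: le_trans (ler_norm_sum _ _ _) _; rewrite /norm1 mulr_suml.
by apply: ler_sum => i _; rewrite normrM ler_wpM2l.
Qed.

Lemma closed_simplex : closed (simplex m : set 'rV[R]_m).
Proof.
have coordc i : continuous (fun w : 'rV[R]_m => w 0 i) by exact: coord_continuous.
rewrite (_ : simplex m = (\bigcap_i [set w : 'rV[R]_m | 0 <= w 0 i]) `&` [set w | norm1 w = 1]).
  apply: closedI.
    apply: closed_bigI => i _.
    by apply: (@preimage_closed _ _ (fun w : 'rV[R]_m => w 0 i) [set x | 0 <= x]) => //;
      exact: closed_ge.
  apply: (@preimage_closed _ _ (@norm1 R m) [set 1]); last exact: closed_eq.
  move=> w _; rewrite /norm1.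
  apply: (@continuous_big _ _ _ _ _ add_continuous) => i _ v.
  apply: (@continuous_comp _ _ _ (fun w : 'rV[R]_m => w 0 i) Num.norm).
    exact: coordc.
  exact: norm_continuous.
apply/seteqP; split=> w [w0 w1]; split=> // i; first by move=> _; exact: w0.
exact: (w0 i I).
Qed.

Lemma compact_simplex : compact (simplex m : set 'rV[R]_m).
Proof.
apply: bounded_closed_compact; last exact: closed_simplex.
exists 1; split=> // x x1 w [w0 w1]; apply: le_trans (ltW x1).
apply: mxnorm_le => // i.
by rewrite -w1 /norm1 (bigD1 i)//= lerDl sumr_ge0.
Qed.

End Simplex.

Section MaxMinScalarization.
Context {R : realType} {m : nat}.
Variables (c : 'rV[R]_m -> 'I_m -> R) (l : 'I_m -> R) (D : R).
Hypotheses (m0 : (0 < m)%N) (D0 : 0 <= D).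
Hypothesis lipc : forall w v i, simplex m w -> simplex m v ->
  `|c w i - c v i| <= D * norm1 (w - v).
Hypothesis optc : forall w v, simplex m w -> simplex m v ->
  \sum_i w 0 i * c w i <= \sum_i w 0 i * c v i.
Hypothesis lec : forall w, simplex m w -> \sum_i w 0 i * c w i <= \sum_i w 0 i * l i.

(** Read [c w] as the cost vector of [Kw w] and [l] as that of the Pareto optimal gain. By [optc],
    [phi] is a lower envelope of functions affine in the weight, hence concave. *)
Let phi (w : 'rV[R]_m) := \sum_i w 0 i * (c w i - l i).

Let phiE (w v : 'rV[R]_m) : \sum_i w 0 i * (c v i - l i) =
  \sum_i w 0 i * c v i - \sum_i w 0 i * l i.
Proof. by rewrite -sumrB; apply: eq_bigr => i _; rewrite mulrBr. Qed.

Let phi_le w v : simplex m w -> simplex m v ->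
  phi w <= \sum_i w 0 i * (c v i - l i).
Proof. by move=> sw sv; rewrite /phi !phiE lerD2r; exact: optc. Qed.

Let gap_bounded : exists2 M, 0 <= M & forall w i, simplex m w -> `|c w i - l i| <= M.
Proof.
pose e : 'rV[R]_m := delta_mx 0 (Ordinal m0).
exists (\sum_i `|c e i - l i| + D * 2).
  by rewrite addr_ge0 ?mulr_ge0// sumr_ge0.
move=> w i sw; rewrite -(subrKA (c e i)) addrC; apply: le_trans (ler_normD _ _) _.
apply: lerD; first by rewrite (bigD1 i)//= lerDl sumr_ge0.
apply: le_trans (lipc i sw (simplex_delta _)) _.
by rewrite ler_wpM2l// norm1_simplex_sub//; exact: simplex_delta.
Qed.

Let phi_lipschitz : exists2 M, 0 <= M &
  forall w v, simplex m w -> simplex m v -> `|phi w - phi v| <= M * `|w - v|.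
Proof.
have [M M0 bM] := gap_bounded; exists (m%:R * M); first by rewrite mulr_ge0.
have half w v : simplex m w -> simplex m v -> phi w - phi v <= m%:R * M * `|w - v|.
  (* The affine function attached to v lies above [phi] and touches it at v, so its slope bounds the
     increment. *)
  move=> sw sv; apply: (@le_trans _ _ (\sum_i (w - v) 0 i * (c v i - l i))).
    rewrite lerBlDr; apply: le_trans (phi_le sw sv) _; rewrite -big_split/=.
    by apply: ler_sum => i _; rewrite -mulrDl !mxE subrK.
  apply: le_trans (ler_norm _) _.
  apply: le_trans (sum_mul_le_norm1 _ (fun i => bM v i sv)) _.
  by rewrite mulrAC ler_wpM2r// norm1_le_mxnorm.
by move=> w v sw sv; rewrite ler_norml lerNl opprB {1}(distrC w v) !half.
Qed.

Lemma exists_phi_max : exists2 w, simplex m w & forall v, simplex m v -> phi v <= phi w.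
Proof.
have [M M0 lipM] := phi_lipschitz.
have [||w ws wmax] := @EVT_max_rV R m phi (simplex m) _ compact_simplex.
- by exists (delta_mx 0 (Ordinal m0)); exact: simplex_delta.
- apply/subspace_continuousP => v sv; apply/cvgrPdist_le => e e0.
  have M1 : 0 < M + 1 by rewrite ltr_wpDl.
  rewrite near_withinE; near=> w => sw.
  apply: le_trans (lipM _ _ sv sw) _.
  apply: (@le_trans _ _ ((M + 1) * (e / (M + 1)))); last by rewrite mulrC divfK ?gt_eqF.
  apply: ler_pM => //; first by rewrite lerDl.
  near: w; apply: cvgr_dist_le; last by rewrite divr_gt0.
  exact: cvg_id.
exists w; first by rewrite inE in ws.
by move=> v sv; apply: wmax; rewrite inE.
Unshelve. all: by end_near. Qed.

(* Let w maximize phi and u = w + t (v - w) for a vertex v.  Then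
   phi u <= phi w <= sum_i w_i (c u i - l i), so sum_i (v - w)_i (c u i - l i) <= 0, and
   t tends to 0; phi need not be differentiable. *)
Lemma scalarized_dominates : exists2 w, simplex m w & forall i, c w i <= l i.
Proof.
have [w sw wmax] := exists_phi_max; exists w => // j.
pose v : 'rV[R]_m := delta_mx 0 j; have sv : simplex m v by exact: simplex_delta.
pose g u := \sum_i (v - w) 0 i * (c u i - l i).
have segment_le (t : R) : 0 < t <= 1 -> g (w + t *: (v - w)) <= 0.
  move=> /andP[t0 t1]; set u := w + _.
  have su : simplex m u by apply: simplex_segment => //; rewrite (ltW t0).
  have := le_trans (wmax _ su) (phi_le sw su).
  have -> : phi u = \sum_i w 0 i * (c u i - l i) + t * g u.
    rewrite /g mulr_sumr -big_split/=; apply: eq_bigr => i _.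
    by rewrite {1}/u !mxE; ring.
  by rewrite gerDl pmulr_rle0.
have gw : g w <= 0.
  apply: (ler_vanishing (D := norm1 (v - w) * (D * norm1 (v - w))) (@cvg_harmonic R)).
  near=> k; set t := harmonic k.
  have t0 : 0 < t by rewrite /t/= invr_gt0.
  have t1 : t <= 1 by rewrite /t/= invf_le1// ler1n.
  (* Subtracting a nonpositive value only increases the bound, and [lipc] makes the difference O(t)
     with t = [harmonic k]. *)
  apply: (@le_trans _ _ (g w - g (w + t *: (v - w)))).
    by rewrite lerDl oppr_ge0 segment_le// t0.
  rewrite add0r /g -sumrB; apply: le_trans (ler_norm _) _.
  under eq_bigr do rewrite -mulrBr.
  rewrite -mulrA; apply: sum_mul_le_norm1 => i.
  rewrite opprB addrA subrK; apply: le_trans (lipc i sw _) _.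
    by apply: simplex_segment => //; rewrite (ltW t0).
  rewrite opprD addrA subrr add0r -scaleNr norm1Z normrN gtr0_norm//.
  by rewrite [t * _]mulrC mulrA.
(* Since v is the vertex j, [g w] is (c w j - l j) - phi w; thus c w j - l j <= phi w <= 0, the last
   step by [lec]. *)
have := phi_le sw sw; have := lec sw; have phiw := phiE w w.
have : g w = (c w j - l j) - phi w.
  have <- : \sum_i v 0 i * (c w i - l i) = c w j - l j.
    rewrite (bigD1 j)//= big1 ?addr0 => [|i /negbTE ij]; rewrite mxE !eqxx ?ij/= ?mul1r//.
    by rewrite mul0r.
  by rewrite /g /phi -sumrB; apply: eq_bigr => i _; rewrite !mxE mulrBl.
rewrite /phi phiw => gE H _; move: gw; rewrite gE; lra.
Unshelve. all: by end_near. Qed.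

End MaxMinScalarization.

Section ParetoFront.
Context {R : realType} {n d m : nat}.
Variables (A : 'M[R]_n) (B : 'M[R]_(n, d)).
Variables (Q : 'I_m -> 'M[R]_n) (Rc : 'I_m -> 'M[R]_d).

Lemma trace_scalarized (w : 'rV[R]_m) K :
  \sum_i w 0 i * \tr (lyap (A + B *m K) (stage_cost (Q i) (Rc i) K)) =
  \tr (lyap (A + B *m K) (stage_cost (Qw Q w) (Rw Rc w) K)).
Proof. by rewrite lyap_scalarized raddf_sum; apply: eq_bigr => i _; rewrite /= mxtraceZ. Qed.

Lemma Kw_optimal iota w K C r C' r' :
  (forall i, possemidef (Q i)) -> (forall i, possemidef (Rc i)) ->
  0 <= iota -> (forall i, coercive iota (Rc i)) -> stabilizable A B ->
  simplex m w -> decay C r (A + B *m Kw A B Q Rc w) -> decay C' r' (A + B *m K) ->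
  \sum_i w 0 i * \tr (lyap (A + B *m Kw A B Q Rc w)
    (stage_cost (Q i) (Rc i) (Kw A B Q Rc w))) <=
  \sum_i w 0 i * \tr (lyap (A + B *m K) (stage_cost (Q i) (Rc i) K)).
Proof.
move=> psdQ psdR i0 cR stab sw dw dK.
have [D DE D0] := Pw_le_lyap psdQ psdR i0 cR stab sw dK.
rewrite [leRHS]trace_scalarized [leLHS]trace_scalarized.
rewrite (lyap_Kw psdQ psdR i0 cR stab sw dw) DE mxtraceD lerDl.
by rewrite mxtrace_quad sumr_ge0.
Qed.

(** Each k contributes one element to the supremum defining [tau]; gam > 0 permits clearing its
    denominator. *)
Lemma tau_decay (L : 'M[R]_n) gam tau0 : 0 < gam < 1 ->
  (tau L gam <= tau0%:E)%E -> decay tau0 gam L.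
Proof.
move=> /andP[g0 g1] tauL.
have pow k : opnorm (L ^+ k) <= tau0 * gam ^+ k.
  rewrite -ler_pdivrMr ?exprn_gt0// -lee_fin; apply: le_trans tauL.
  by apply: ereal_sup_ubound; exists k.
split; last by move=> k; apply: bnd_le (pow k) (bnd_opnorm _).
  by apply: le_trans (opnorm_ge0 (L ^+ 0)) _; have := pow 0%N; rewrite expr0 mulr1.
by rewrite ltW.
Qed.

Local Notation G := (Gamma A B Q Rc).

Lemma bigmax7_ge (a b c e f g h : R) (M := \big[Num.max/0]_(x <- [:: a; b; c; e; f; g; h]) x) :
  [/\ a <= M, b <= M, c <= M, e <= M & [/\ f <= M, g <= M & h <= M]].
Proof. by rewrite /M !big_cons big_nil !le_max !lexx !orbT. Qed.

Lemma Gamma_ge : [/\ 1 + Pmax A B Q Rc <= G, 1 + Kmax A B Q Rc <= G,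
  opnorm_plus A <= G, opnorm_plus B <= G &
  [/\ \big[Num.max/0]_i opnorm (Q i) <= G, \big[Num.max/0]_i opnorm (Rc i) <= G &
      1 + m%:R * \big[Num.max/0]_i opnorm (invmx (Rc i)) <= G]].
Proof. exact: bigmax7_ge. Qed.

End ParetoFront.

Lemma row_sub_entry (V : zmodType) m (u v : 'rV[V]_m) i :
  (u - v) 0 i = u 0 i - v 0 i.
Proof. by rewrite !mxE. Qed.

Theorem theorem2 (R : realType) :
  exists c C : R, 0 < c /\ 0 < C /\
  forall (n d m : nat) (A : 'M[R]_n) (B : 'M[R]_(n, d))
    (Q : 'I_m -> 'M[R]_n) (Rc : 'I_m -> 'M[R]_d) (sigma : R)
    (disp : measure_display) (Omega : measurableType disp)
    (P : probability Omega R)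
    (x0 : {RV P >-> n.-tuple R}) (xi : nat -> {RV P >-> n.-tuple R})
    (gammabar taubar eps : R) (N : set 'rV[R]_m),
    (d <= n)%N -> (0 < m)%N -> 0 < sigma ->
    stabilizable A B ->
    (forall i, posdef (Q i)) -> (forall i, posdef (Rc i)) ->
    (forall i, 1 <= sigma_min (Q i)) -> (forall i, 1 <= sigma_min (Rc i)) ->
    lqr_noise sigma x0 xi ->
    0 < gammabar < 1 ->
    (forall w, simplex m w ->
       spectral_radius (A + B *m Kw A B Q Rc w) <= gammabar) ->
    (forall w, simplex m w ->
       (tau (A + B *m Kw A B Q Rc w) gammabar <= taubar%:E)%E) ->
    0 < eps ->
    eps <= c * ((1 - gammabar ^+ 2) ^+ 4 / taubar ^+ 4)
             * Gamma A B Q Rc ^- 17 ->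
    l1_net eps N ->
    let L := lqr_costs A B x0 xi Q Rc in
    forall K, pareto_optimal (stabilizing A B) L K ->
    exists2 Keps, [set Kw A B Q Rc w | w in N] Keps &
      (* the norm of a row vector is its sup norm *)
      `|L K - L Keps| <=
        C * sigma ^+ 2 * n%:R * Gamma A B Q Rc ^+ 29
          * (taubar ^+ 8 / (1 - gammabar ^+ 2) ^+ 4) * eps.
Proof.
exists 1, (16 * 50); split; first exact: ltr01.
split; first by rewrite mulr_gt0 ?ltr0n.
move=> n d m A B Q Rc sigma disp Omega P x0 xi gam tau0 eps N _ m0 sigma0 stab.
move=> pdQ pdR _ _ noise gam01 specK tauK eps0 _ [Nsub Nnet] L K [stabK parK].
have psdQ i := posdef_semi (pdQ i); have psdR i := posdef_semi (pdR i).
have /andP[gam0 gam1] := gam01.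
pose iota := \big[Num.max/0]_i opnorm (invmx (Rc i)).
have iota0 : 0 <= iota by exact: bigmax_ge_id.
have cR i : coercive iota (Rc i).
  by apply: posdef_coercive => //; exact: (le_bigmax _ (fun i => opnorm (invmx (Rc i))) i).
pose s2 := normal_second_moment sigma.
have /andP[s2_ge0 s2_le] : 0 <= s2 <= 16 * sigma ^+ 2 by exact: normal_second_moment_bounds.
pose trX K' i := \tr (lyap (A + B *m K') (stage_cost (Q i) (Rc i) K')).
have costE K' i : stabilizing A B K' -> L K' 0 i = s2 * trX K' i.
  by move=> /spectral_radius_decay[C [r dK']]; rewrite mxE (lqr_noise_costE sigma0 noise _ _ dK').
clearbody L.
have stabKw w : simplex m w -> stabilizing A B (Kw A B Q Rc w).
  by move=> sw; apply: le_lt_trans (specK w sw) gam1.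
have sdelta : simplex m (delta_mx 0 (Ordinal m0) : 'rV[R]_m) by exact: simplex_delta.
(* For n = 0 all traces are empty and every cost is 0; T >= 1 is only available for n > 0. *)
have [n0|] := posnP n.
  have [w Nw _] := Nnet _ sdelta.
  exists (Kw A B Q Rc w); first by exists w.
  have tr0 K' i : trX K' i = 0.
    rewrite /trX /mxtrace big1// => -[k kn] _; exfalso.
    by have := leq_ltn_trans (leq0n k) kn; rewrite n0.
  have -> : L K - L (Kw A B Q Rc w) = 0.
    apply/rowP => i; rewrite row_sub_entry costE// costE; last exact/stabKw/Nsub.
    by rewrite !tr0 mulr0 subrr mxE.
  have nR0 : n%:R = 0 :> R by rewrite n0.
  by rewrite normr0 nR0 mulr0 !mul0r.
move=> n0; set G := Gamma A B Q Rc.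
have [GP GK GA GB [GQ GR Giota]] := Gamma_ge A B Q Rc.
rewrite -/G in GP GK GA GB GQ GR Giota.
have P0 : 0 <= Pmax A B Q Rc.
  exact: le_trans (opnorm_ge0 _) (opnorm_Pw_le psdQ psdR iota0 cR stab sdelta).
have G1 : 1 <= G by apply: le_trans GP; rewrite lerDl.
have G0 : 0 <= G by exact: le_trans ler01 G1.
have iotaG : iota <= G.
  (* Uses m >= 1: [Gamma] contains m times the maximum that defines [iota]. *)
  apply: le_trans Giota; apply: (@le_trans _ _ (m%:R * iota)); last by rewrite lerDr.
  by rewrite ler_peMl// ler1n.
have bA : bnd G A by apply: bnd_le (bnd_opnorm _); apply: le_trans GA; rewrite lerDr.
have bB : bnd G B by apply: bnd_le (bnd_opnorm _); apply: le_trans GB; rewrite lerDr.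
have bQ i : bnd G (Q i).
  by apply: bnd_le (bnd_opnorm _); apply: le_trans GQ;
     exact: (le_bigmax _ (fun i => opnorm (Q i))).
have bR i : bnd G (Rc i).
  by apply: bnd_le (bnd_opnorm _); apply: le_trans GR;
     exact: (le_bigmax _ (fun i => opnorm (Rc i))).
have bK w : simplex m w -> bnd G (Kw A B Q Rc w).
  move=> sw; apply: bnd_le (bnd_opnorm _); apply: le_trans GK.
  by apply: le_trans (opnorm_Kw_le psdQ psdR iota0 cR stab sw) _; rewrite lerDr.
have dK w : simplex m w -> decay tau0 gam (A + B *m Kw A B Q Rc w).
  by move=> sw; apply: tau_decay => //; exact: tauK.
have T1 := decay_ratio_ge1 n0 (dK _ sdelta); set T := tau0 ^+ 2 / _ in T1.
have lip w v i e : simplex m w -> simplex m v -> 0 <= e -> norm1 (w - v) <= e ->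
    `|L (Kw A B Q Rc w) 0 i - L (Kw A B Q Rc v) 0 i| <=
    s2 * (n%:R * (50 * G ^+ 13 * T ^+ 3 * e)).
  move=> sw sv e0 wv; rewrite !costE; try exact: stabKw.
  rewrite -mulrBr normrM (ger0_norm s2_ge0) ler_wpM2l//.
  exact: (value_trace_lipschitz psdQ psdR iota0 cR stab G1 iotaG T1 (erefl T)
    bA bB bQ bR bK dK sw sv e0 wv).
pose D := s2 * (n%:R * (50 * G ^+ 13 * T ^+ 3)).
have T0 : 0 <= T by exact: le_trans ler01 T1.
have D0 : 0 <= D.
  by rewrite mulr_ge0// mulr_ge0// mulr_ge0 ?exprn_ge0// mulr_ge0// exprn_ge0.
have opt w K' : simplex m w -> stabilizing A B K' ->
    \sum_i w 0 i * L (Kw A B Q Rc w) 0 i <= \sum_i w 0 i * L K' 0 i.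
  move=> sw stabK'; have [C [r dK']] := spectral_radius_decay stabK'.
  have sum_costE K'' : stabilizing A B K'' ->
      \sum_i w 0 i * L K'' 0 i = s2 * \sum_i w 0 i * trX K'' i.
    by move=> ?; rewrite mulr_sumr; apply: eq_bigr => i _; rewrite costE// mulrCA.
  rewrite [leRHS](sum_costE K' stabK') [leLHS](sum_costE _ (stabKw w sw)).
  apply: ler_wpM2l; first exact: s2_ge0.
  exact (Kw_optimal psdQ psdR iota0 cR stab sw (dK w sw) dK').
clear bK dK; set Kf := Kw A B Q Rc in lip opt stabKw *; clearbody Kf.
have [|||w sw Lw_le] := @scalarized_dominates R m (fun w i => L (Kf w) 0 i)
    (fun i => L K 0 i) D m0 D0.
- move=> w v i sw sv; apply: le_trans (lip w v i _ sw sv (norm1_ge0 _) (lexx _)) _.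
  by rewrite /D -!mulrA.
- by move=> w v sw sv; exact (opt w _ sw (stabKw v sv)).
- by move=> w sw; exact (opt w K sw stabK).
have Lw_eq i : L (Kf w) 0 i = L K 0 i.
  apply/eqP; rewrite eq_le Lw_le/= leNgt; apply/negP => lt_i; apply: parK.
  by exists (Kf w); split; [exact: stabKw|exact: Lw_le|exists i].
have [w' Nw' ww'] := Nnet w sw.
exists (Kf w'); first by exists w'.
have r0 : 0 <= 1 - gam ^+ 2 by rewrite subr_ge0 expr_le1// ltW.
have -> : tau0 ^+ 8 / (1 - gam ^+ 2) ^+ 4 = T ^+ 4.
  by rewrite /T exprMn exprVn -exprM.
clearbody T.
have b0 : 0 <= n%:R * (50 * G ^+ 13 * T ^+ 3 * eps).
  rewrite mulr_ge0// mulr_ge0 ?(ltW eps0)//.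
  by rewrite mulr_ge0 ?exprn_ge0// mulr_ge0 ?exprn_ge0.
have main : s2 * (n%:R * (50 * G ^+ 13 * T ^+ 3 * eps)) <=
    16 * 50 * sigma ^+ 2 * n%:R * G ^+ 29 * T ^+ 4 * eps.
  rewrite (_ : 16 * 50 * sigma ^+ 2 * n%:R * G ^+ 29 * T ^+ 4 * eps =
    (16 * sigma ^+ 2) * (n%:R * (50 * (G ^+ 29 * T ^+ 4 * eps)))); last by ring.
  have := monomial_le G1 T1 (ltW eps0) (isT : 13 <= 29)%N (isT : 3 <= 4)%N => mono.
  apply: ler_pM => //.
  apply: ler_wpM2l => //.
  have -> : 50 * G ^+ 13 * T ^+ 3 * eps = 50 * (G ^+ 13 * T ^+ 3 * eps) by rewrite !mulrA.
  exact: ler_wpM2l.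
apply: mxnorm_le => [|i].
  by apply: le_trans main; rewrite mulr_ge0.
apply: le_trans main; rewrite row_sub_entry -Lw_eq.
by apply: lip => //; [exact: Nsub|exact: ltW].
Qed.
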